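(* Let $a_0,a_1,\dots,a_6$ and $b$ be real constants, and let $J$ be the 5-manifold $\mathbb{R}^5$ with coordinates $(x,y,p,q,z)$. Let $g_F$ be the $(3,2)$-signature metric on $J$ given by \begin{align*} 15\,(2)^{-2/3}g_F={}&[\,9a_2+2b^2+27a_3p+54a_4p^2+90a_5p^3+135a_6p^4\,]\,dy^2\\ &+[\,15a_0+2(b^2-3a_2)p^2-3a_3p^3+9a_4p^4+30a_5p^5+60a_6p^6-20bpq+5q^2+15bz\,]\,dx^2\\ &+[\,15a_1+4(3a_2-b^2)p-9a_3p^2-48a_4p^3-105a_5p^4-180a_6p^5+20bq\,]\,dx\,dy\\ &+20\,dp^2-10(bp+q)\,dp\,dx+10b\,dp\,dy-30\,dq\,dy-15\,dx\,dz+30p\,dq\,dx. \end{align*} Then the bilinear form \begin{align*} \tilde g_F={}&t^2g_F-2\,dt\,du\\ &-2tu\Big[\tfrac1{20}\big(-2a_2+4b^2+3a_3p+6a_4p^2-20a_5p^3-120a_6p^4\big)dx^2\\ &\qquad\quad-\tfrac9{20}\big(a_3-10a_5p^2-40a_6p^3\big)dx\,dy-\tfrac9{10}\big(a_4+5a_5p+15a_6p^2\big)dy^2\Big]\\ &+u^2\Big[\tfrac{3}{20(2)^{2/3}}\big(a_4-10a_5p+60a_6p^2\big)dx^2+\tfrac{9}{4(2)^{2/3}}\big(a_5-12a_6p\big)dx\,dy+\tfrac{81}{4(2)^{2/3}}a_6\,dy^2\Big] \end{align*} on $J\times\mathbb{R}_+\times\mathbb{R}$, with coordinates $(x,y,p,q,z,t,u)$,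 $t>0$, which is a metric of signature $(4,3)$ in a neighbourhood of $u=0$, is Ricci flat, $Ric(\tilde g_F)\equiv0$, and it is the Fefferman–Graham ambient metric for $g_F$.
   Context: Products of 1-forms such as $dx\,dy$ or $dt\,du$ are symmetric products, $\theta\eta=\tfrac12(\theta\otimes\eta+\eta\otimes\theta)$. Tensors on $J$ are pulled back to $J\times\mathbb{R}_+\times\mathbb{R}$ by the projection $(x,y,p,q,z,t,u)\mapsto(x,y,p,q,z)$, with the pullback sign omitted. The metric $g_F$ is a representative of the $(3,2)$-signature conformal class on $J$ associated with the ordinary differential equation $z'=F(x,y,y',y'',z)$ (with $p=y'$, $q=y''$) with defining function $F=q^2+a_6p^6+a_5p^5+a_4p^4+a_3p^3+a_2p^2+a_1p+a_0+bz$; for the purposes of the statement $g_F$ is completely given by the displayed formula. Fefferman–Graham ambient metric: given a metric $g$ on a 5-manifold $J$, consider all formal series $$-2\,dt\,du+t^2g-ut\,\alpha+u^2\beta+u^3t^{-1}\gamma+\sum_{k=4}^\infty u^kt^{2-k}\mu_k$$ on $J\times\mathbb{R}_+\times\mathbb{R}$ (coordinates $t>0$, $u$ on the last two factors), where $\alpha,\beta,\gamma,\mu_k$ are (pullbacks of) symmetric bilinear forms on $J$. By a theorem of Fefferman and Graham exactly one of these formal bilinear forms has vanishing Ricci tensor; it is called the ambient metric for $g$. *)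

(* Defs.v *)
From HB Require Import structures.
From mathcomp Require Import all_boot all_order all_algebra.
From mathcomp Require Import all_classical all_reals all_analysis.
Import Order.TTheory GRing.Theory Num.Theory.
Import numFieldNormedType.Exports.

Set Implicit Arguments.
Unset Strict Implicit.
Unset Printing Implicit Defensive.

Local Open Scope classical_set_scope.
Local Open Scope ring_scope.

(** * Calculus on R^n *)

Definition partial (R : realType) (n : nat) (i : 'I_n)
    (f : 'rV[R]_n -> R) : 'rV[R]_n -> R :=
  fun v => 'D_(delta_mx 0 i) f v.

(* C^infinity on an open set [D]: every iterated partial derivative is
   (Frechet) differentiable at every point of [D]. *)
Definition smooth_on (R : realType) (n : nat) (D : set 'rV[R]_n)
    (f : 'rV[R]_n -> R) : Prop :=
  forall (s : seq 'I_n) (v : 'rV[R]_n), D v ->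
    differentiable (foldr (@partial R n) f s) v.

(** * Bilinear forms and metrics

   A bilinear form on R^n is its Gram matrix, a 1-form is a row vector, and a
   field of bilinear forms on R^n is a function ['rV_n -> 'M_n]. *)

Definition symprod (R : realType) (n : nat) (th et : 'rV[R]_n) : 'M[R]_n :=
  2^-1 *: (th^T *m et + et^T *m th).

Notation "th (.) et" := (symprod th et)
  (at level 40, left associativity) : ring_scope.

Definition has_signature (R : realType) (n : nat) (B : 'M[R]_n)
    (p q : nat) : Prop :=
  [/\ B^T = B, (p + q)%N = n &
      exists2 P : 'M[R]_n, P \in unitmx &
        P *m B *m P^T = diag_mx (\row_i (if (i < p)%N then 1 else -1))].

Definition metric_on (R : realType) (n : nat) (D : set 'rV[R]_n)
    (g : 'rV[R]_n -> 'M[R]_n) (p q : nat) : Prop :=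
  (forall i j, smooth_on D (fun v => g v i j)) /\
  (forall v, D v -> has_signature (g v) p q).

(** * Ricci curvature

   The coordinate formulas make sense for any space [A] of "functions" with a
   product [mul] and partial derivatives [D].  They are used below both for
   functions on R^n and for formal power series. *)

Definition christoffel (R : realType) (A : lmodType R) (n : nat)
    (mul : A -> A -> A) (D : 'I_n -> A -> A) (g ginv : 'I_n -> 'I_n -> A)
    (k i j : 'I_n) : A :=
  2^-1 *: \sum_l mul (ginv k l) (D i (g j l) + D j (g i l) - D l (g i j)).

Definition ricci (R : realType) (A : lmodType R) (n : nat)
    (mul : A -> A -> A) (D : 'I_n -> A -> A) (g ginv : 'I_n -> 'I_n -> A)
    (i j : 'I_n) : A :=
  let G := christoffel mul D g ginv in
  \sum_k (D k (G k i j) - D j (G k i k)) +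
  \sum_k \sum_l (mul (G k k l) (G l i j) - mul (G k j l) (G l i k)).

Definition ricci_tensor (R : realType) (n : nat) (g : 'rV[R]_n -> 'M[R]_n)
    (v : 'rV[R]_n) : 'M[R]_n :=
  \matrix_(i, j)
    ricci (A := 'rV[R]_n -> R^o) (fun f h w => f w * h w) (@partial R n)
      (fun k l w => g w k l) (fun k l w => invmx (g w) k l) i j v.

(** * The space J x R_+ x R

   [J] is R^5 with coordinates (x,y,p,q,z); J x R_+ is the part [0 < t] of
   R^(5+1) and J x R_+ x R is the part [0 < t] of R^(5+1+1). *)

Definition ix : 'I_5 := @Ordinal 5 0 isT.
Definition iy : 'I_5 := @Ordinal 5 1 isT.
Definition ip : 'I_5 := @Ordinal 5 2 isT.
Definition iq : 'I_5 := @Ordinal 5 3 isT.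
Definition iz : 'I_5 := @Ordinal 5 4 isT.

Definition dcoord (R : realType) (n : nat) (i : 'I_n) : 'rV[R]_n := delta_mx 0 i.

Definition it1 : 'I_(5 + 1) := rshift 5 ord0.
Definition it : 'I_(5 + 1 + 1) := lshift 1 it1.
Definition iu : 'I_(5 + 1 + 1) := rshift (5 + 1) ord0.

(* Pullback to J x R_+ x R of a bilinear form on J. *)
Definition pull (R : realType) (B : 'M[R]_5) : 'M[R]_(5 + 1 + 1) :=
  block_mx (block_mx B 0 0 0) 0 0 0.

(** * Formal series in u

   A formal bilinear form on J x R_+ x R is the sequence of its coefficients
   of [u ^+ k], which are matrices depending on the point of J x R_+. *)

Definition formal_fun (R : realType) : Type := nat -> 'rV[R]_(5 + 1) -> R^o.

Definition formal_form (R : realType) : Type :=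
  nat -> 'rV[R]_(5 + 1) -> 'M[R]_(5 + 1 + 1).

Definition formal_mul (R : realType) (a b : formal_fun R) : formal_fun R :=
  fun k v => \sum_(i < k.+1) a i v * b (k - i)%N v.

(* Coefficientwise for x,y,p,q,z,t; formal derivative of a series for u. *)
Definition formal_partial (R : realType) (i : 'I_(5 + 1 + 1))
    (a : formal_fun R) : formal_fun R :=
  match fintype.split i with
  | inl j => fun k => partial j (a k)
  | inr _ => fun k v => k.+1%:R * a k.+1 v
  end.

Definition formal_inverse (R : realType) (S H : formal_form R) : Prop :=
  forall (i j : 'I_(5 + 1 + 1)) (k : nat) (v : 'rV[R]_(5 + 1)),
    0 < v 0 it1 ->
    \sum_l formal_mul (fun n w => S n w i l) (fun n w => H n w l j) k v
    = ((k == 0%N) && (i == j))%:R.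

Definition formal_ricci_flat (R : realType) (S : formal_form R) : Prop :=
  exists2 H : formal_form R, formal_inverse S H &
    forall (i j : 'I_(5 + 1 + 1)) (k : nat) (v : 'rV[R]_(5 + 1)),
      0 < v 0 it1 ->
      ricci (A := nat -> 'rV[R]_(5 + 1) -> R^o)
        (@formal_mul R) (@formal_partial R)
        (fun a b n w => S n w a b) (fun a b n w => H n w a b) i j k v = 0.

(** * Fefferman-Graham ambient metrics *)

Definition symmetric_tensor (R : realType) (B : 'rV[R]_5 -> 'M[R]_5) : Prop :=
  (forall v, (B v)^T = B v) /\
  (forall i j, smooth_on setT (fun v => B v i j)).

(* -2 dt du + t^2 g - u t al + u^2 be + u^3 t^-1 ga
     + sum_(k >= 4) u^k t^(2-k) mu_k *)
Definition ambient_series (R : realType) (g al be ga : 'rV[R]_5 -> 'M[R]_5)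
    (mu : nat -> 'rV[R]_5 -> 'M[R]_5) : formal_form R :=
  fun k v =>
    let y : 'rV[R]_5 := lsubmx v in
    let t := v 0 it1 in
    match k with
    | 0 => - 2 *: (dcoord R it (.) dcoord R iu) + t ^+ 2 *: pull (g y)
    | 1 => - t *: pull (al y)
    | 2 => pull (be y)
    | 3 => t^-1 *: pull (ga y)
    | _ => t ^ (2 - k%:Z) *: pull (mu k y)
    end.

Definition has_ambient_form (R : realType) (g : 'rV[R]_5 -> 'M[R]_5)
    (S : formal_form R) : Prop :=
  exists al be ga : 'rV[R]_5 -> 'M[R]_5,
  exists mu : nat -> 'rV[R]_5 -> 'M[R]_5,
    [/\ symmetric_tensor al, symmetric_tensor be, symmetric_tensor ga,
        forall k, symmetric_tensor (mu k) &
        forall k (v : 'rV[R]_(5 + 1)), 0 < v 0 it1 ->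
          S k v = ambient_series g al be ga mu k v].

(* [S] is the one formal series of the prescribed form with vanishing Ricci
   tensor. *)
Definition is_formal_ambient (R : realType) (g : 'rV[R]_5 -> 'M[R]_5)
    (S : formal_form R) : Prop :=
  [/\ has_ambient_form g S, formal_ricci_flat S &
      forall S' : formal_form R, has_ambient_form g S' -> formal_ricci_flat S' ->
        forall k (v : 'rV[R]_(5 + 1)), 0 < v 0 it1 -> S' k v = S k v].

(* A field of bilinear forms on J x R_+ x R is the ambient metric for [g] when
   it is the sum of the ambient formal series. *)
Definition is_ambient_metric (R : realType) (g : 'rV[R]_5 -> 'M[R]_5)
    (G : 'rV[R]_(5 + 1 + 1) -> 'M[R]_(5 + 1 + 1)) : Prop :=
  exists2 S : formal_form R, is_formal_ambient g S &
    forall (w : 'rV[R]_(5 + 1 + 1)) (i j : 'I_(5 + 1 + 1)), 0 < w 0 it ->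
      series (fun k => w 0 iu ^+ k * S k (lsubmx w) i j) @ \oo --> G w i j.

(** * The metrics *)

Definition gF (R : realType) (a0 a1 a2 a3 a4 a5 a6 b : R)
    (v : 'rV[R]_5) : 'M[R]_5 :=
  let dx := dcoord R ix in let dy := dcoord R iy in let dp := dcoord R ip in
  let dq := dcoord R iq in let dz := dcoord R iz in
  let p := v 0 ip in let q := v 0 iq in let z := v 0 iz in
  (15 * 2 `^ (- (2 / 3)))^-1 *:
  ((9 * a2 + 2 * b ^+ 2 + 27 * a3 * p + 54 * a4 * p ^+ 2
      + 90 * a5 * p ^+ 3 + 135 * a6 * p ^+ 4) *: (dy (.) dy)
   + (15 * a0 + 2 * (b ^+ 2 - 3 * a2) * p ^+ 2 - 3 * a3 * p ^+ 3
      + 9 * a4 * p ^+ 4 + 30 * a5 * p ^+ 5 + 60 * a6 * p ^+ 6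
      - 20 * b * p * q + 5 * q ^+ 2 + 15 * b * z) *: (dx (.) dx)
   + (15 * a1 + 4 * (3 * a2 - b ^+ 2) * p - 9 * a3 * p ^+ 2
      - 48 * a4 * p ^+ 3 - 105 * a5 * p ^+ 4 - 180 * a6 * p ^+ 5
      + 20 * b * q) *: (dx (.) dy)
   + 20 *: (dp (.) dp) - (10 * (b * p + q)) *: (dp (.) dx)
   + (10 * b) *: (dp (.) dy) - 30 *: (dq (.) dy) - 15 *: (dx (.) dz)
   + (30 * p) *: (dq (.) dx)).

Definition gF_coef1 (R : realType) (a2 a3 a4 a5 a6 b : R)
    (v : 'rV[R]_5) : 'M[R]_5 :=
  let dx := dcoord R ix in let dy := dcoord R iy in
  let p := v 0 ip in
  (20^-1 * (- 2 * a2 + 4 * b ^+ 2 + 3 * a3 * p + 6 * a4 * p ^+ 2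
            - 20 * a5 * p ^+ 3 - 120 * a6 * p ^+ 4)) *: (dx (.) dx)
  - (9 / 20 * (a3 - 10 * a5 * p ^+ 2 - 40 * a6 * p ^+ 3)) *: (dx (.) dy)
  - (9 / 10 * (a4 + 5 * a5 * p + 15 * a6 * p ^+ 2)) *: (dy (.) dy).

Definition gF_coef2 (R : realType) (a4 a5 a6 : R)
    (v : 'rV[R]_5) : 'M[R]_5 :=
  let dx := dcoord R ix in let dy := dcoord R iy in
  let p := v 0 ip in
  let c : R := 2 `^ (2 / 3) in
  (3 / (20 * c) * (a4 - 10 * a5 * p + 60 * a6 * p ^+ 2)) *: (dx (.) dx)
  + (9 / (4 * c) * (a5 - 12 * a6 * p)) *: (dx (.) dy)
  + (81 / (4 * c) * a6) *: (dy (.) dy).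

Definition tgF (R : realType) (a0 a1 a2 a3 a4 a5 a6 b : R)
    (w : 'rV[R]_(5 + 1 + 1)) : 'M[R]_(5 + 1 + 1) :=
  let y : 'rV[R]_5 := lsubmx (lsubmx w) in
  let t := w 0 it in let u := w 0 iu in
  t ^+ 2 *: pull (gF a0 a1 a2 a3 a4 a5 a6 b y)
  - 2 *: (dcoord R it (.) dcoord R iu)
  - (2 * t * u) *: pull (gF_coef1 a2 a3 a4 a5 a6 b y)
  + u ^+ 2 *: pull (gF_coef2 a4 a5 a6 y).

(* Main.v *)
Require Import Defs.
From Stdlib Require Import BinNums BinPos BinNat BinInt Nnat Pnat Ring_theory Ring_polynom.
From Stdlib Require QArith_base Qreduction.
From mathcomp Require Import all_boot all_order all_algebra.
From mathcomp Require Import all_classical all_reals all_analysis.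
From mathcomp Require Import ssrZ ring.
Import Order.TTheory GRing.Theory Num.Theory.
Import numFieldNormedType.Exports.

(** In the coordinates p, q, z, t, u the coefficients of the ambient metric are
   polynomials in p, q, z, t, u; since dx and dy span a null plane for the inverse
   of g_F and the terms in u only involve dx and dy, the inverse metric is
   polynomial in p, q, z, t, 1/t, u, and so is the Ricci tensor. Its vanishing
   is a polynomial identity, decided by normalizing symbolic expressions. The
   same identity is read twice: with u a coordinate function, and with u the
   variable of a formal series. A frame adapted to the null plane gives the
   signatures.

   For uniqueness, let two Ricci flat series of ambient form agree up to order n
   in u and let d be the difference of their coefficients of order n + 1. At
   order n the tangential components of the two Ricci tensors differ by
   (n + 1) / (2 t) times (3 - 2 n) d + (tr d) t^2 g, where the trace is taken for
   t^2 g, and at order n - 1 the (u, u) components differ by -(n / 2) (n + 1) tr d.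
   Hence tr d = 0 (by contracting the first relation if n = 0), and d = 0
   because 3 - 2 n is odd. *)

Set Implicit Arguments.
Unset Strict Implicit.
Unset Printing Implicit Defensive.

Local Open Scope classical_set_scope.
Local Open Scope ring_scope.

Local Notation Q := QArith_base.Q.
Local Notation Qnum := QArith_base.Qnum.
Local Notation Qden := QArith_base.Qden.
Local Notation Qmake := QArith_base.Qmake.

(** * Symbolic expressions with rational coefficients *)

(** The obstacle is the size of the Ricci tensor, so it is computed once, on expressions with
    rational coefficients in seventeen letters. The quantities 1/t, 2^(2/3), 2^(-1/3) and the square
    root of 3 are letters too, tied by three relations; this keeps the computation inside binary
    arithmetic, and real values enter only through an assignment to the letters. The assignments are
    taken in [{poly R}]: with constants for all letters this is evaluation at a point, with ['X] for
    u the coefficients of the value are those of a series in u, so the formal inverse and the formal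
    Ricci tensor become finite objects. Differentiation stays syntactic because the derivative of
    every letter is again an expression, and smoothness comes along, since functions given by
    expressions are closed under partial derivatives.

    In the uniqueness argument 3 - 2 n arises as (dim J - 2) - 2 n: the odd dimension of J keeps
    this factor from vanishing at any order, so that no coefficient of the series is left free. *)

Definition expr : Type := PExpr Q.

Declare Scope expr_scope.
Delimit Scope expr_scope with X.
Bind Scope expr_scope with expr.
Bind Scope expr_scope with PExpr.
Notation "x + y" := (PEadd x y) : expr_scope.
Notation "x - y" := (PEsub x y) : expr_scope.
Notation "x * y" := (PEmul x y) : expr_scope.
Notation "- x" := (PEopp x) : expr_scope.
Notation "x ^ n" := (PEpow x n) : expr_scope.

Definition rat_expr (n : Z) (d : positive) : expr := PEc (Qmake n d).
Notation "n // d" := (rat_expr n d)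
  (at level 35, no associativity) : expr_scope.
Notation "'# n" := (rat_expr n 1)
  (at level 2, format "''#' n") : expr_scope.

Section RationalValues.
Variable R : realType.

(** Coefficients are pairs of binary integers, on which [vm_compute] is efficient. Their equality is
    only [Qeq], so compatibility with the reducing operations goes through [ratQ_eq]. *)
Definition ratQ (x : Q) : R :=
  (int_of_Z (Qnum x))%:~R / (int_of_Z (Zpos (Qden x)))%:~R.

Lemma int_of_pos_neq0 (d : positive) : (int_of_Z (Zpos d))%:~R != 0 :> R.
Proof.
rewrite intr_eq0; apply/eqP => /(congr1 Z_of_int).
by rewrite int_of_ZK.
Qed.

Let ZM (x y : Z) : int_of_Z (Z.mul x y) = int_of_Z x * int_of_Z y.
Proof. exact: rmorphM. Qed.

Lemma ratQ_eq (x y : Q) : QArith_base.Qeq x y -> ratQ x = ratQ y.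
Proof.
rewrite /QArith_base.Qeq /ratQ => e; apply/eqP.
by rewrite eqr_div ?int_of_pos_neq0 // -!intrM -!ZM e.
Qed.

Lemma ratQ_add (x y : Q) : ratQ (Qreduction.Qplus' x y) = ratQ x + ratQ y.
Proof.
rewrite (ratQ_eq (Qreduction.Qplus'_correct x y)) /ratQ.
rewrite addf_div ?int_of_pos_neq0 // -!intrM -!ZM -intrD.
by rewrite -(rmorphD int_of_Z).
Qed.

Lemma ratQ_mul (x y : Q) : ratQ (Qreduction.Qmult' x y) = ratQ x * ratQ y.
Proof.
rewrite (ratQ_eq (Qreduction.Qmult'_correct x y)) /ratQ mulf_div.
by rewrite -!intrM -!ZM.
Qed.

Lemma ratQ_opp (x : Q) : ratQ (QArith_base.Qopp x) = - ratQ x.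
Proof. by rewrite /ratQ /= -mulNr -mulrNz -rmorphN. Qed.

Lemma ratQ_sub (x y : Q) : ratQ (Qreduction.Qminus' x y) = ratQ x - ratQ y.
Proof. by rewrite -[LHS]/(ratQ (Qreduction.Qplus' _ _)) ratQ_add ratQ_opp. Qed.

Lemma ratQ0 : ratQ (Qmake 0 1) = 0.
Proof. by rewrite /ratQ mul0r. Qed.

Lemma ratQ1 : ratQ (Qmake 1 1) = 1.
Proof. by rewrite /ratQ divr1. Qed.

End RationalValues.

(** The ring of values is left open: real numbers give functions of the coordinates, polynomials
    give series in u. *)
Definition ev (A : comNzRingType) (phi : Q -> A) (l : seq A) (e : expr) : A :=
  PEeval 0 1 +%R *%R (fun x y => x - y) -%R phi id
    (fun x n => x ^+ N.to_nat n) l e.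

Lemma pow_NE (A : comNzRingType) (x : A) (n : N) :
  x ^+ N.to_nat n = pow_N 1 *%R x n.
Proof.
case: n => [|p] //=; elim: p => [p IH|p IH|] //=; rewrite -IH -exprD addnn.
  by rewrite Pos2Nat.inj_xI exprS multE mul2n.
by rewrite Pos2Nat.inj_xO multE mul2n.
Qed.

Lemma jump_map (A B : Type) (f : A -> B) p (l : seq A) :
  BinList.jump p (map f l) = map f (BinList.jump p l).
Proof.
have tlE (s : seq A) : List.tl (map f s) = map f (List.tl s) by case: s.
by elim: p l => [p IH|p IH|] l /=; rewrite ?tlE ?IH.
Qed.

Lemma nth_map_positive (A B : Type) (f : A -> B) x0 p (l : seq A) :
  BinList.nth (f x0) p (map f l) = f (BinList.nth x0 p l).
Proof.
have tlE (s : seq A) : List.tl (map f s) = map f (List.tl s) by case: s.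
by elim: p l => [p IH|p IH|] l /=; rewrite ?tlE ?jump_map ?IH //; case: l.
Qed.

(** Naturality, applied below to the embedding of constants into polynomials and to evaluation of a
    polynomial at a point. *)
Lemma ev_rmorph (A B : comNzRingType) (phi : Q -> A) (f : {rmorphism A -> B})
    (l : seq A) (e : expr) :
  ev (f \o phi) (map f l) e = f (ev phi l e).
Proof.
rewrite /ev; elim: e => //=.
- by rewrite rmorph0.
- by rewrite rmorph1.
- by move=> p; have := nth_map_positive f 0 p l; rewrite rmorph0.
- by move=> x -> y ->; rewrite rmorphD.
- by move=> x -> y ->; rewrite rmorphB.
- by move=> x -> y ->; rewrite rmorphM.
- by move=> x ->; rewrite rmorphN.
- by move=> x -> n; rewrite rmorphXn.
Qed.

(* In every evaluation [xtau] is 1/t, [xc] is 2^(2/3), [xsig] is 2^(-1/3) and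
   [xrho] is the square root of 3; the polynomial relations between them are
   listed in [relations]. *)
Definition xt : expr := PEX Q 1.
Definition xtau : expr := PEX Q 2.
Definition xu : expr := PEX Q 3.
Definition xp : expr := PEX Q 4.
Definition xq : expr := PEX Q 5.
Definition xz : expr := PEX Q 6.
Definition xc : expr := PEX Q 7.
Definition xsig : expr := PEX Q 8.
Definition xrho : expr := PEX Q 9.
Definition xa0 : expr := PEX Q 10.
Definition xa1 : expr := PEX Q 11.
Definition xa2 : expr := PEX Q 12.
Definition xa3 : expr := PEX Q 13.
Definition xa4 : expr := PEX Q 14.
Definition xa5 : expr := PEX Q 15.
Definition xa6 : expr := PEX Q 16.
Definition xb : expr := PEX Q 17.

Definition relations : seq (expr * expr) :=
  [:: (xt * xtau, '#1); (xsig ^ 2 * xc, '#1); (xrho ^ 2, '#3)]%X.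

(* Division by 1 is all that is needed to rewrite with [relations], whose left
   hand sides have leading coefficient 1. *)
Definition Qdivide (x y : Q) : Q * Q :=
  if QArith_base.Qeq_bool y (Qmake 1 1) then (x, Qmake 0 1) else (Qmake 0 1, x).

(** The number 20 bounds the rounds of rewriting with [relations]. Rewriting preserves values, so
    too small a bound could make a check fail but never make it unsound. *)
Definition norm_expr (e : expr) : Pol Q :=
  let rels := mk_monpol_list (Qmake 0 1) (Qmake 1 1) Qreduction.Qplus'
    Qreduction.Qmult' Qreduction.Qminus' QArith_base.Qopp QArith_base.Qeq_bool
    Qdivide relations in
  norm_subst (Qmake 0 1) (Qmake 1 1) Qreduction.Qplus'
    Qreduction.Qmult' Qreduction.Qminus' QArith_base.Qopp QArith_base.Qeq_bool
    Qdivide 20 rels e.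

Definition is_zero (e : expr) : bool :=
  Ring_polynom.Peq QArith_base.Qeq_bool (norm_expr e) (Pc (Qmake 0 1)).

(** Sparse Horner forms number their variables relatively; [j] is the absolute number of the current
    first one. Reading a normal form back as an expression allows intermediate results to be
    simplified and then differentiated further. *)
Fixpoint reify (j : positive) (x : Pol Q) : expr :=
  match x with
  | Pc c => PEc c
  | Ring_polynom.Pinj i x => reify (i + j) x
  | PX x i y => (reify j x * PEX Q j ^ (Npos i) + reify (1 + j) y)%X
  end.

Definition normalize (e : expr) : expr := reify 1 (norm_expr e).

(** * Soundness of normalization in a commutative ring *)

Section Normalization.
Variables (A : comNzRingType) (phi : Q -> A).
Hypotheses
  (phi0 : phi (Qmake 0 1) = 0) (phi1 : phi (Qmake 1 1) = 1)
  (phiD : forall x y, phi (Qreduction.Qplus' x y) = phi x + phi y)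
  (phiB : forall x y, phi (Qreduction.Qminus' x y) = phi x - phi y)
  (phiM : forall x y, phi (Qreduction.Qmult' x y) = phi x * phi y)
  (phiN : forall x, phi (QArith_base.Qopp x) = - phi x)
  (phi_eq : forall x y, QArith_base.Qeq x y -> phi x = phi y).
Variable l : seq A.
Hypotheses (ttau : ev phi l (xt * xtau)%X = 1)
  (sigc : ev phi l (xsig ^ 2 * xc)%X = 1)
  (rho3 : ev phi l (xrho ^ 2)%X = phi (Qmake 3 1)).

Let ring_th : almost_ring_theory 0 1 +%R *%R (fun x y : A => x - y) -%R Logic.eq.
Proof.
split=> //.
- exact: add0r.
- exact: addrC.
- exact: addrA.
- exact: mul1r.
- exact: mul0r.
- exact: mulrC.
- exact: mulrA.
- exact: mulrDl.
- by move=> x y; rewrite mulNr.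
- exact: opprD.
Qed.

Let pow_th : power_theory 1 *%R Logic.eq id
  (fun (x : A) n => x ^+ N.to_nat n).
Proof. by split=> x n; rewrite pow_NE. Qed.

Let morph : ring_morph 0 1 +%R *%R (fun x y : A => x - y) -%R Logic.eq
  (Qmake 0 1) (Qmake 1 1) Qreduction.Qplus' Qreduction.Qmult'
  Qreduction.Qminus' QArith_base.Qopp QArith_base.Qeq_bool phi.
Proof.
by split=> // x y /QArith_base.Qeq_bool_eq /phi_eq.
Qed.

Let div_th : div_theory Logic.eq Qreduction.Qplus' Qreduction.Qmult' phi Qdivide.
Proof.
split=> x y; rewrite /Qdivide.
case: (boolP (QArith_base.Qeq_bool y (Qmake 1 1))) => [/QArith_base.Qeq_bool_eq|_].
  by move=> /phi_eq e; rewrite phiD phiM e phi0 phi1 mul1r addr0.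
by rewrite phiD phiM phi0 mulr0 add0r.
Qed.

Let norm_exprE e : ev phi l e = Pphi 0 +%R *%R phi l (norm_expr e).
Proof.
apply: (norm_subst_ok (Eqsth A) (Eq_ext _ _ _) ring_th morph pow_th div_th).
split; first exact: etrans ttau (esym phi1).
by split; [exact: etrans sigc (esym phi1) | exact: rho3].
Qed.

Lemma is_zero_ev e : is_zero e -> ev phi l e = 0.
Proof.
rewrite norm_exprE /is_zero => h.
by rewrite (Peq_ok (Eqsth A) (Eq_ext _ _ _) morph _ _ h l).
Qed.

(** Variables are numbered from 1: dropping [j] entries of [0 :: l] leaves the list that starts at
    variable [j]. *)
Let ev_reify j x : ev phi l (reify j x) =
  Pphi 0 +%R *%R phi (BinList.jump j (0 :: l)) x.
Proof.
elim: x j => //= [i x IH|x IHx i y IHy] j.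
  by rewrite IH BinList.jump_add.
rewrite -[LHS]/(ev phi l (reify j x) * BinList.nth 0 j l ^+ Pos.to_nat i
  + ev phi l (reify (1 + j) y)) IHx IHy BinList.jump_add /=.
by rewrite -BinList.nth_jump (pow_NE _ (Npos i)).
Qed.

Lemma ev_normalize e : ev phi l (normalize e) = ev phi l e.
Proof. by rewrite ev_reify -norm_exprE. Qed.

End Normalization.

(** * Real and polynomial values of expressions *)

Section PolynomialValues.
Variable R : realType.

Definition evR (l : seq R) (e : expr) : R := ev (@ratQ R) l e.

Definition evP (l : seq {poly R}) (e : expr) : {poly R} :=
  ev (fun x => (ratQ R x)%:P) l e.

Lemma evP_polyC (l : seq R) (e : expr) :
  evP (map polyC l) e = (evR l e)%:P.
Proof. exact: (ev_rmorph (@ratQ R) (@polyC R)). Qed.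

Lemma horner_evP (l : seq {poly R}) (e : expr) (x : R) :
  (evP l e).[x] = evR (map (horner^~ x) l) e.
Proof.
have := ev_rmorph (fun y => (ratQ R y)%:P) (horner_eval x) l e.
rewrite /= /horner_eval /evP => <-; congr (ev _ _ e).
by apply/funext => y /=; rewrite hornerC.
Qed.

Definition admissible (l : seq {poly R}) : Prop :=
  [/\ evP l (xt * xtau)%X = 1, evP l (xsig ^ 2 * xc)%X = 1 &
      evP l (xrho ^ 2)%X = 3%:P].

Section PolynomialConstants.
Let phi (x : Q) : {poly R} := (ratQ R x)%:P.

Let phi0 : phi (Qmake 0 1) = 0. Proof. by rewrite /phi ratQ0. Qed.
Let phi1 : phi (Qmake 1 1) = 1. Proof. by rewrite /phi ratQ1. Qed.
Let phi3 : phi (Qmake 3 1) = 3%:P. Proof. by rewrite /phi /ratQ divr1. Qed.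

Let phiD x y : phi (Qreduction.Qplus' x y) = phi x + phi y.
Proof. by rewrite /phi ratQ_add polyCD. Qed.

Let phiB x y : phi (Qreduction.Qminus' x y) = phi x - phi y.
Proof. by rewrite /phi ratQ_sub polyCB. Qed.

Let phiM x y : phi (Qreduction.Qmult' x y) = phi x * phi y.
Proof. by rewrite /phi ratQ_mul polyCM. Qed.

Let phiN x : phi (QArith_base.Qopp x) = - phi x.
Proof. by rewrite /phi ratQ_opp polyCN. Qed.

Let phi_eq x y : QArith_base.Qeq x y -> phi x = phi y.
Proof. by move=> /ratQ_eq xy; rewrite /phi xy. Qed.

Lemma evP_normalize l e : admissible l -> evP l (normalize e) = evP l e.
Proof.
case=> h1 h2; rewrite -phi3 => h3.
exact: (ev_normalize phi0 phi1 phiD phiB phiM phiN phi_eq h1 h2 h3).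
Qed.

Lemma evP_is_zero l e : admissible l -> is_zero e -> evP l e = 0.
Proof.
case=> h1 h2; rewrite -phi3 => h3.
exact: (is_zero_ev phi0 phi1 phiD phiB phiM phiN phi_eq h1 h2 h3).
Qed.

End PolynomialConstants.

Lemma evR_is_zero l e : admissible (map polyC l) -> is_zero e -> evR l e = 0.
Proof.
move=> hl he; apply: (polyC_inj (R := R)).
by rewrite -evP_polyC evP_is_zero.
Qed.

End PolynomialValues.

(** * Partial derivatives of evaluated expressions *)

(** The chain rule: [dv] gives the derivative of each letter as an expression, because a letter such
    as 1/t is a function of the coordinates and not one of them. *)
Fixpoint dexpr (dv : positive -> expr) (e : expr) : expr :=
  match e with
  | PEX j => dv j
  | PEadd x y => dexpr dv x + dexpr dv y
  | PEsub x y => dexpr dv x - dexpr dv y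
  | PEmul x y => dexpr dv x * y + x * dexpr dv y
  | PEopp x => - dexpr dv x
  | PEpow x n => rat_expr (Z.of_N n) 1 * x ^ N.pred n * dexpr dv x
  | _ => '#0
  end%X.

(** The difference of the two functions vanishes near the point, so the zero map is a differential
    of it. *)
Lemma near_eq_differentiable (R : realType) (V W : normedModType R) (f g : V -> W) (x : V) :
  (\near x, f x = g x) -> differentiable f x -> differentiable g x.
Proof.
move=> fg df; pose h := g - f.
have -> : g = f + h by rewrite /h addrC subrK.
apply: differentiableD => //.
have h0 : \forall y \near x, h y = 0.
  by near=> y; rewrite /h /= -[LHS]/(g y - f y) (near fg y) // subrr.
have hx : h x = 0 by exact: nbhs_singleton h0.
apply/diffP.
(* The differential is a chosen linear map, so it is enough to exhibit one map with its defining
   property. *)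
apply: (@getPex _ (fun (df : {linear V -> W}) => continuous df /\
  forall y, h y = h (lim (nbhs x)) + df (y - lim (nbhs x))
                  +o_(y \near x) (y - lim (nbhs x)))).
exists (\0 : {linear V -> W}); split; first exact: cst_continuous.
suff H : h = (fun y : V => h (lim (nbhs x)) + (\0 : {linear V -> W}) (y - lim (nbhs x)))
    +o_ (nbhs x) (fun y : V => y - lim (nbhs x)) by rewrite funeqE in H.
apply/eqaddoP => e e0; near=> y.
rewrite lim_id // /= -[X in `|X|]/(h y - (h x + 0)) hx (near h0 y) // !addr0 subrr normr0.
by rewrite mulr_ge0 // ltW.
Unshelve. all: by end_near. Qed.

Section Derivatives.
Variables (R : realType) (n : nat) (dom : set 'rV[R]_n).
Hypothesis open_dom : open dom.

Lemma partial_eq_on (i : 'I_n) (f g : 'rV[R]_n -> R) :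
  (forall v, dom v -> f v = g v) ->
  forall v, dom v -> partial i f v = partial i g v.
Proof.
move=> fg v dv; apply: near_eq_derive.
by near=> w; apply: fg; near: w; exact: open_nbhs_nbhs.
Unshelve. all: by end_near. Qed.

Lemma differentiable_eq_on (f g : 'rV[R]_n -> R) :
  (forall v, dom v -> f v = g v) ->
  forall v, dom v -> differentiable f v -> differentiable g v.
Proof.
move=> fg v dv; apply: near_eq_differentiable.
by near=> w; apply: fg; near: w; exact: open_nbhs_nbhs.
Unshelve. all: by end_near. Qed.

(** Differentiability travels with the value of the derivative: the product rule requires it, and
    smoothness is then obtained from the same induction. *)
Definition has_partial (i : 'I_n) (f f' : 'rV[R]_n -> R) : Prop :=
  forall v, dom v -> differentiable f v /\ partial i f v = f' v.

(** A polynomial-valued function is treated as the family of its coefficients, so [{poly R}] needs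
    no topology. *)
Definition has_partialP (i : 'I_n) (F F' : 'rV[R]_n -> {poly R}) : Prop :=
  forall k, has_partial i (fun v => (F v)`_k) (fun v => (F' v)`_k).

Variable i : 'I_n.

Lemma has_partial_cst (a : R) : has_partial i (fun=> a) (fun=> 0).
Proof. by move=> v _; split; [exact: differentiable_cst | exact: derive_cst]. Qed.

Lemma has_partialD f f' g g' : has_partial i f f' -> has_partial i g g' ->
  has_partial i (fun v => f v + g v) (fun v => f' v + g' v).
Proof.
move=> hf hg v dv; have [df <-] := hf v dv; have [dg <-] := hg v dv.
by split; [exact: differentiableD | apply: deriveD; exact: diff_derivable].
Qed.

Lemma has_partialN f f' : has_partial i f f' ->
  has_partial i (fun v => - f v) (fun v => - f' v).
Proof.
move=> hf v dv; have [df <-] := hf v dv.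
by split; [exact: differentiableN | apply: deriveN; exact: diff_derivable].
Qed.

Lemma has_partialM f f' g g' : has_partial i f f' -> has_partial i g g' ->
  has_partial i (fun v => f v * g v) (fun v => f' v * g v + f v * g' v).
Proof.
move=> hf hg v dv; have [df <-] := hf v dv; have [dg <-] := hg v dv.
split; first exact: differentiableM.
rewrite [LHS]deriveM; [|exact: diff_derivable..].
by rewrite addrC [_ *: _]mulrC.
Qed.

Lemma eq_has_partial f g f' g' : f =1 g -> f' =1 g' ->
  has_partial i g g' -> has_partial i f f'.
Proof. by move=> /funext -> /funext ->. Qed.

Lemma has_partial_sum m (f f' : 'I_m -> 'rV[R]_n -> R) :
  (forall j, has_partial i (f j) (f' j)) ->
  has_partial i (fun v => \sum_j f j v) (fun v => \sum_j f' j v).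
Proof.
elim: m f f' => [|m IH] f f' h.
  by apply: eq_has_partial (has_partial_cst 0) => v; rewrite big_ord0.
apply: eq_has_partial (has_partialD (h ord0) (IH _ _ (fun j => h (lift ord0 j)))).
  by move=> v; rewrite big_ord_recl.
by move=> v; rewrite big_ord_recl.
Qed.

Lemma eq_has_partialP F G F' G' : F =1 G -> F' =1 G' ->
  has_partialP i G G' -> has_partialP i F F'.
Proof. by move=> /funext -> /funext ->. Qed.

Lemma has_partialP_cst p : has_partialP i (fun=> p) (fun=> 0).
Proof.
by move=> k; apply: eq_has_partial (has_partial_cst p`_k) => v; rewrite ?coef0.
Qed.

Lemma has_partialPD F F' G G' : has_partialP i F F' -> has_partialP i G G' ->
  has_partialP i (fun v => F v + G v) (fun v => F' v + G' v).
Proof.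
by move=> hF hG k; apply: eq_has_partial (has_partialD (hF k) (hG k)) => v;
  rewrite coefD.
Qed.

Lemma has_partialPN F F' : has_partialP i F F' ->
  has_partialP i (fun v => - F v) (fun v => - F' v).
Proof.
by move=> hF k; apply: eq_has_partial (has_partialN (hF k)) => v; rewrite coefN.
Qed.

Lemma has_partialPM F F' G G' : has_partialP i F F' -> has_partialP i G G' ->
  has_partialP i (fun v => F v * G v) (fun v => F' v * G v + F v * G' v).
Proof.
move=> hF hG k.
apply: eq_has_partial (has_partial_sum
    (fun j : 'I_k.+1 => has_partialM (hF j) (hG (k - j)%N))) => v.
  by rewrite coefM.
by rewrite coefD !coefM -big_split.
Qed.

Lemma has_partialPX F F' m : has_partialP i F F' ->
  has_partialP i (fun v => F v ^+ m) (fun v => m%:R * F v ^+ m.-1 * F' v).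
Proof.
move=> hF; elim: m => [|m IH].
  by apply: eq_has_partialP (has_partialP_cst 1) => v; rewrite ?expr0 ?mul0r.
apply: eq_has_partialP (has_partialPM hF IH) => v; first by rewrite exprS.
case: m {IH} => [|m] /=; first by rewrite !mul0r mulr0 addr0 mul1r mulrC.
by rewrite exprS [m.+2%:R]mulrSr; ring.
Qed.

Variables (env : 'rV[R]_n -> seq {poly R}) (dv : positive -> expr).
Hypothesis env_dv : forall p,
  has_partialP i (fun v => BinList.nth 0 p (env v)) (fun v => evP (env v) (dv p)).

Lemma ratQ_N m : ratQ R (Qmake (Z.of_N m) 1) = (N.to_nat m)%:R.
Proof. by rewrite /ratQ divr1 /=; case: m => [|p] //. Qed.

Lemma has_partialP_evP e :
  has_partialP i (fun v => evP (env v) e) (fun v => evP (env v) (dexpr dv e)).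
Proof.
have ev0 p : has_partialP i (fun=> p) (fun v => evP (env v) '#0%X).
  apply: eq_has_partialP (has_partialP_cst p) => v //.
  by rewrite /evP /ev /= ratQ0.
elim: e => [||c|p|x IHx y IHy|x IHx y IHy|x IHx y IHy|x IHx|x IHx m] /=.
- exact: ev0.
- exact: ev0.
- exact: ev0.
- exact: env_dv.
- exact: has_partialPD.
- by apply: has_partialPD => //; exact: has_partialPN.
- exact: has_partialPM.
- exact: has_partialPN.
apply: eq_has_partialP (has_partialPX (N.to_nat m) IHx) => v //.
by rewrite {1}/evP /ev /= ratQ_N polyCMn N2Nat.inj_pred.
Qed.

End Derivatives.

(** The counterpart for u read as an indeterminate: differentiation in ['X] obeys the same syntactic
    rules as a partial derivative. *)
Lemma deriv_evP (R : realType) (l : seq {poly R}) (dv : positive -> expr) :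
  (forall p, (BinList.nth 0 p l)^`() = evP l (dv p)) ->
  forall e, (evP l e)^`() = evP l (dexpr dv e).
Proof.
have ev0 : evP l '#0%X = 0 by rewrite /evP /ev /= ratQ0.
move=> h; elim=> [||c|p|x IHx y IHy|x IHx y IHy|x IHx y IHy|x IHx|x IHx m] /=.
- exact: etrans (deriv0 _) (esym ev0).
- exact: etrans (derivC _) (esym ev0).
- exact: etrans (derivC _) (esym ev0).
- exact: h.
- by rewrite [LHS]derivD IHx IHy.
- by rewrite [LHS]derivB IHx IHy.
- by rewrite [LHS]derivM IHx IHy.
- by rewrite [LHS]derivN IHx.
- transitivity ((N.to_nat m)%:R * evP l x ^+ (N.to_nat m).-1 *
      evP l (dexpr dv x)); last first.
    rewrite -[RHS]/((ratQ R (Qmake (Z.of_N m) 1))%:P *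
      evP l x ^+ N.to_nat (N.pred m) * evP l (dexpr dv x)).
    by rewrite ratQ_N polyCMn N2Nat.inj_pred.
  by rewrite [LHS]deriv_exp IHx -mulr_natl -mulrA [_ ^+ _ * _]mulrC.
Qed.

(** * The ambient metric as a matrix of expressions *)

(** The coordinates p, q, z, t, u have indices 2 to 6 and are the letters 4, 5, 6, 1, 3. The entry
    (5, 2) is the t-derivative of 1/t. The coordinates x and y occur in no coefficient of the metric
    and have no letter. *)
Definition dcoord_expr (i : nat) (p : positive) : expr :=
  match i, Pos.to_nat p with
  | 2, 4 | 3, 5 | 4, 6 | 5, 1 | 6, 3 => '#1
  | 5, 2 => - xtau ^ 2
  | _, _ => '#0
  end%X.

Section MetricExpressions.
Local Open Scope expr_scope.

Definition tbl (l : seq (seq expr)) (i j : nat) : expr :=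
  nth '#0 (nth [::] l i) j.

Definition g_xx : expr :=
  '#15 * xa0 + '#2 * (xb ^ 2 - '#3 * xa2) * xp ^ 2 - '#3 * xa3 * xp ^ 3
  + '#9 * xa4 * xp ^ 4 + '#30 * xa5 * xp ^ 5 + '#60 * xa6 * xp ^ 6
  - '#20 * xb * xp * xq + '#5 * xq ^ 2 + '#15 * xb * xz.
Definition g_xy : expr :=
  '#15 * xa1 + '#4 * ('#3 * xa2 - xb ^ 2) * xp - '#9 * xa3 * xp ^ 2
  - '#48 * xa4 * xp ^ 3 - '#105 * xa5 * xp ^ 4 - '#180 * xa6 * xp ^ 5
  + '#20 * xb * xq.
Definition g_yy : expr :=
  '#9 * xa2 + '#2 * xb ^ 2 + '#27 * xa3 * xp + '#54 * xa4 * xp ^ 2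
  + '#90 * xa5 * xp ^ 3 + '#135 * xa6 * xp ^ 4.

(** The factor 2^(2/3) / 15 is the inverse of 15 * 2^(-2/3). Symmetric products halve the mixed
    coefficients, and entries left out of the table read as 0. *)
Definition coef0_expr : nat -> nat -> expr :=
  let k := (1 // 15) * xc in
  tbl [:: [:: k * g_xx; (1 // 2) * k * g_xy; - ('#5 * k * (xb * xp + xq));
              '#15 * k * xp; - ((15 // 2) * k)];
          [:: (1 // 2) * k * g_xy; k * g_yy; '#5 * k * xb; - ('#15 * k)];
          [:: - ('#5 * k * (xb * xp + xq)); '#5 * k * xb; '#20 * k];
          [:: '#15 * k * xp; - ('#15 * k)];
          [:: - ((15 // 2) * k)]].

Definition coef1_expr : nat -> nat -> expr :=
  let xy := (9 // 40) * (xa3 - '#10 * xa5 * xp ^ 2 - '#40 * xa6 * xp ^ 3) in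
  tbl [:: [:: (1 // 20) * (- '#2 * xa2 + '#4 * xb ^ 2 + '#3 * xa3 * xp
                + '#6 * xa4 * xp ^ 2 - '#20 * xa5 * xp ^ 3
                - '#120 * xa6 * xp ^ 4); - xy];
          [:: - xy; - ((9 // 10) * (xa4 + '#5 * xa5 * xp
                         + '#15 * xa6 * xp ^ 2))]].

Definition coef2_expr : nat -> nat -> expr :=
  let xy := (9 // 8) * xsig ^ 2 * (xa5 - '#12 * xa6 * xp) in
  tbl [:: [:: (3 // 20) * xsig ^ 2 * (xa4 - '#10 * xa5 * xp
                + '#60 * xa6 * xp ^ 2); xy];
          [:: xy; (81 // 4) * xsig ^ 2 * xa6]].

(** Among indices below 7 the sum 11 singles out the pair t, u, where -2 dt du contributes -1. *)
Definition metric_expr (i j : nat) : expr :=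
  if ((i < 5) && (j < 5))%N then
    xt ^ 2 * coef0_expr i j - '#2 * xt * xu * coef1_expr i j
    + xu ^ 2 * coef2_expr i j
  else if (i + j == 11)%N then - '#1 else '#0.

(* Coordinates of the fields X, Y that together with the coordinate fields of
   p, q, z form a frame in which the metric is block antidiagonal up to the
   upper left 2 x 2 block [frame_xx, frame_xy; frame_xy, frame_yy]. *)
Definition vec (l : seq expr) (i : nat) : expr := nth '#0 l i.
Definition unit_vec (k i : nat) : expr := if i == k then '#1 else '#0.
Definition frame_X : nat -> expr := vec [:: '#1; xp; (1 // 4) * xq].
Definition frame_Y : nat -> expr := vec [:: '#0; '#1; - ((1 // 4) * xb)].
Definition frame_K : expr := (1 // 15) * xc * xt ^ 2.
Definition frame_K' : expr := '#15 * xsig ^ 2 * xtau ^ 2.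
Definition frame_xx : expr :=
  metric_expr 0 0 + '#2 * xp * metric_expr 0 1 + xp ^ 2 * metric_expr 1 1
  - (5 // 4) * frame_K * xq ^ 2.
Definition frame_xy : expr :=
  metric_expr 0 1 + xp * metric_expr 1 1 + (5 // 4) * frame_K * xq * xb.
Definition frame_yy : expr := metric_expr 1 1 - (5 // 4) * frame_K * xb ^ 2.

Definition sym_expr (v w : nat -> expr) (i j : nat) : expr :=
  v i * w j + w i * v j.

(** Read off from the frame X, Y and the fields of p, q, z, with K = [frame_K]: the field of p has
    square 20 K and is orthogonal to the others, X pairs with z to -15 K / 2 and Y pairs with q to
    -15 K. The terms with [frame_xx], [frame_xy], [frame_yy] compensate the upper left block; their
    coefficients are minus the products of 2/15 and 1/15. *)
Definition inverse_expr (i j : nat) : expr :=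
  (1 // 20) * frame_K' * (unit_vec 2 i * unit_vec 2 j)
  - (2 // 15) * frame_K' * sym_expr frame_X (unit_vec 4) i j
  - (1 // 15) * frame_K' * sym_expr frame_Y (unit_vec 3) i j
  - (4 // 225) * frame_K' ^ 2 * frame_xx * (unit_vec 4 i * unit_vec 4 j)
  - (2 // 225) * frame_K' ^ 2 * frame_xy * sym_expr (unit_vec 4) (unit_vec 3) i j
  - (1 // 225) * frame_K' ^ 2 * frame_yy * (unit_vec 3 i * unit_vec 3 j)
  - sym_expr (unit_vec 5) (unit_vec 6) i j.

(* A pseudo-orthonormal frame: X and Y are first made null by adding multiples
   of the null coordinate fields of z and q. *)
Definition null_X (i : nat) : expr :=
  frame_X i + (1 // 15) * frame_K' * (frame_xx * unit_vec 4 i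
                                      + frame_xy * unit_vec 3 i).
Definition null_Y (i : nat) : expr :=
  frame_Y i + (1 // 30) * frame_K' * frame_yy * unit_vec 3 i.

(** A pair of null vectors yields, by difference and sum, two vectors of opposite squares, here 15 K
    = 2^(2/3) t^2 up to sign; this explains the factor 2^(-1/3) / t. The field of p has square 20 K,
    which is 4/3 of that, whence half the square root of 3. *)
Definition orthonormal_frame (k i : nat) : expr :=
  match k with
  | 0 => (1 // 2) * xrho * xsig * xtau * unit_vec 2 i
  | 1 => xsig * xtau * (null_X i - unit_vec 4 i)
  | 2 => xsig * xtau * (null_Y i - (1 // 2) * unit_vec 3 i)
  | 3 => xsig * xtau * (null_X i + unit_vec 4 i)
  | 4 => xsig * xtau * (null_Y i + (1 // 2) * unit_vec 3 i)
  | 5 => unit_vec 5 i - (1 // 2) * unit_vec 6 i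
  | _ => unit_vec 5 i + (1 // 2) * unit_vec 6 i
  end.

Definition sum_expr (n : nat) (f : nat -> expr) : expr :=
  foldr (fun i e => f i + e) '#0 (iota 0 n).

(** Tables in place of functions: each entry is normalized once and then looked up, so the
    expressions handed to the next differentiation stay small. *)
Definition tab2 (f : nat -> nat -> expr) : seq (seq expr) :=
  mkseq (fun i => mkseq (fun j => normalize (f i j)) 7) 7.
Definition tab3 (f : nat -> nat -> nat -> expr) : seq (seq (seq expr)) :=
  mkseq (fun i => tab2 (f i)) 7.
Definition tbl3 (l : seq (seq (seq expr))) (k i j : nat) : expr :=
  tbl (nth [::] l k) i j.

Definition pd (i : nat) : expr -> expr := dexpr (dcoord_expr i).

Definition christoffel_tab : seq (seq (seq expr)) :=
  let gt := tab2 metric_expr in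
  let ht := tab2 inverse_expr in
  let lower := tab3 (fun l i j =>
    pd i (tbl gt j l) + pd j (tbl gt i l) - pd l (tbl gt i j)) in
  tab3 (fun k i j =>
    (1 // 2) * sum_expr 7 (fun l => tbl ht k l * tbl3 lower l i j)).

Definition ricci_of (G : nat -> nat -> nat -> expr) (i j : nat) : expr :=
  sum_expr 7 (fun k => pd k (G k i j) - pd j (G k i k)) +
  sum_expr 7 (fun k => sum_expr 7 (fun l => G k k l * G l i j - G k j l * G l i k)).

Definition for_all2 (n : nat) (P : nat -> nat -> bool) : bool :=
  all (fun i => all (P i) (iota 0 n)) (iota 0 n).

End MetricExpressions.

(** * Symbolic verification of the inverse, the Ricci tensor and the frame *)

Lemma for_all2P n P : for_all2 n P ->
  forall i j, (i < n)%N -> (j < n)%N -> P i j.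
Proof.
move=> /allP h i j hi hj.
by move: (h i); rewrite mem_iota => /(_ hi) /allP; apply; rewrite mem_iota.
Qed.

Lemma metric_inverse_check : for_all2 7 (fun i j => is_zero
  (sum_expr 7 (fun l => metric_expr i l * inverse_expr l j)
     - (if i == j then '#1 else '#0))%X).
Proof. by vm_compute. Qed.

(** The table is bound by [let] so that it is computed once and shared by the 49 components. *)
Lemma ricci_check :
  let T := christoffel_tab in for_all2 7 (fun i j => is_zero (ricci_of (tbl3 T) i j)).
Proof. by vm_compute. Qed.

Lemma frame_check : for_all2 7 (fun a b => is_zero
  (sum_expr 7 (fun k => sum_expr 7 (fun l =>
     orthonormal_frame a k * metric_expr k l * orthonormal_frame b l))
   - (if a == b then if (a < 3)%N || (a == 5) then '#1 else - '#1
      else '#0))%X).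
Proof. by vm_compute. Qed.

(** For the signature of g_F: the first five frame vectors have no component along t or u, and the
    identity is evaluated at t = 1, u = 0. *)
Lemma frame5_check : for_all2 5 (fun a b => is_zero
  (sum_expr 5 (fun k => sum_expr 5 (fun l =>
     orthonormal_frame a k * metric_expr k l * orthonormal_frame b l))
   - (if a == b then if (a < 3)%N then '#1 else - '#1 else '#0))%X).
Proof. by vm_compute. Qed.

(** * Entries of symmetric products and of pullbacks *)

Lemma symprod_dcoordE (R : realType) n (a b i j : 'I_n) :
  (dcoord R a (.) dcoord R b) i j =
  2^-1 * (((i == a) && (j == b))%:R + ((i == b) && (j == a))%:R).
Proof.
by rewrite !mxE !big_ord1 !mxE !eqxx /= -!natrM !mulnb.
Qed.

Lemma ord7P (i : 'I_(5 + 1 + 1)) :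
  [\/ exists i' : 'I_5, i = lshift 1 (lshift 1 i'), i = it | i = iu].
Proof.
case: (splitP i) => [j ij|j ij].
  case: (splitP j) => [k jk|k jk].
    by constructor 1; exists k; apply: val_inj; rewrite /= ij jk.
  by constructor 2; apply: val_inj; rewrite /= ij jk; case: k {jk} => -[].
by constructor 3; apply: val_inj; rewrite /= ij; case: j {ij} => -[].
Qed.

Lemma ord5_eqF (k : 'I_5) m : (k == (5 + m)%N :> nat) = false.
Proof. by rewrite ltn_eqF // ltn_addr. Qed.

Lemma lshift_it (k : 'I_5) : (lshift 1 (lshift 1 k) == it) = false.
Proof. exact: (ord5_eqF k 0). Qed.

Lemma lshift_iu (k : 'I_5) : (lshift 1 (lshift 1 k) == iu) = false.
Proof. exact: (ord5_eqF k 1). Qed.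

Lemma it_iu : (it == iu) = false. Proof. by []. Qed.

Lemma iu_it : (iu == it) = false. Proof. by []. Qed.

Section Pullback.
Variables (R : realType) (B : 'M[R]_5).

Lemma pull_lshift i j :
  pull B (lshift 1 (lshift 1 i)) (lshift 1 (lshift 1 j)) = B i j.
Proof. by rewrite /pull !block_mxEul. Qed.

Lemma pull_it_l j : pull B it j = 0.
Proof.
rewrite /pull /it; case: (ord7P j) => [[j' ->]| -> | ->].
- by rewrite block_mxEul block_mxEdl mxE.
- by rewrite block_mxEul block_mxEdr mxE.
- by rewrite block_mxEur mxE.
Qed.

Lemma pull_iu_l j : pull B iu j = 0.
Proof.
rewrite /pull /iu; case: (ord7P j) => [[j' ->]| -> | ->].
- by rewrite block_mxEdl mxE.
- by rewrite block_mxEdl mxE.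
- by rewrite block_mxEdr mxE.
Qed.

Lemma tr_pull : (pull B)^T = pull B^T.
Proof. by rewrite /pull !tr_block_mx !trmx0. Qed.

End Pullback.

Lemma pull_it_r (R : realType) (B : 'M[R]_5) i : pull B i it = 0.
Proof. by rewrite -[B]trmxK -tr_pull mxE pull_it_l. Qed.

Lemma pull_iu_r (R : realType) (B : 'M[R]_5) i : pull B i iu = 0.
Proof. by rewrite -[B]trmxK -tr_pull mxE pull_iu_l. Qed.

Lemma pull0 (R : realType) : pull (0 : 'M[R]_5) = 0.
Proof.
apply/matrixP => i j; rewrite [RHS]mxE.
case: (ord7P i) => [[i' ->]| -> | ->]; last 2 first.
- by rewrite pull_it_l.
- by rewrite pull_iu_l.
case: (ord7P j) => [[j' ->]| -> | ->].
- by rewrite pull_lshift mxE.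
- by rewrite pull_it_r.
- by rewrite pull_iu_r.
Qed.

Lemma pullZ (R : realType) (x : R) (B : 'M[R]_5) : pull (x *: B) = x *: pull B.
Proof. by rewrite /pull !scale_block_mx !scaler0. Qed.

Lemma ratQ_pos (R : realType) (n d : positive) :
  ratQ R (Qmake (Zpos n) d) = (Pos.to_nat n)%:R / (Pos.to_nat d)%:R.
Proof. by []. Qed.

(** * Assignments of values to the letters *)

Section Environments.
Variables (R : realType) (a0 a1 a2 a3 a4 a5 a6 b : R).

Let c : R := 2 `^ (2 / 3).
Let sig : R := (Num.sqrt c)^-1.
Let rho : R := Num.sqrt 3.

Definition env (A : Type) (f : R -> A) (t tau u p q z : A) : seq A :=
  [:: t; tau; u; p; q; z; f c; f sig; f rho;
      f a0; f a1; f a2; f a3; f a4; f a5; f a6; f b].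

Let c_gt0 : 0 < c. Proof. by rewrite powR_gt0. Qed.
Let c_neq0 : c != 0. Proof. by rewrite gt_eqF. Qed.

Let sig2 : sig ^+ 2 = c^-1.
Proof. by rewrite exprVn sqr_sqrtr // ltW. Qed.

Lemma env_admissible (t : R) (u p q z : {poly R}) : t != 0 ->
  admissible (env polyC t%:P t^-1%:P u p q z).
Proof.
move=> t0; split; rewrite /evP /ev /= -?polyCM ?mulfV //.
  by rewrite -polyC_exp -polyCM sig2 mulVf.
by rewrite -polyC_exp sqr_sqrtr.
Qed.

Lemma coef0_exprE t tau u (y : 'rV[R]_5) (i j : 'I_5) :
  evR (env id t tau u (y 0 ip) (y 0 iq) (y 0 iz)) (coef0_expr i j) =
  gF a0 a1 a2 a3 a4 a5 a6 b y i j.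
Proof.
rewrite /gF powRN -/c invfM invrK.
rewrite !(symprod_dcoordE, mxE) -!val_eqE /evR /ev.
case: i => [[|[|[|[|[|i]]]]] hi] //; case: j => [[|[|[|[|[|j]]]]] hj] //=;
  by rewrite ?ratQ_pos ?ratQ0 /Pos.to_nat /=; field.
Qed.

Lemma coef1_exprE t tau u (y : 'rV[R]_5) (i j : 'I_5) :
  evR (env id t tau u (y 0 ip) (y 0 iq) (y 0 iz)) (coef1_expr i j) =
  gF_coef1 a2 a3 a4 a5 a6 b y i j.
Proof.
rewrite /gF_coef1.
rewrite !(symprod_dcoordE, mxE) -!val_eqE /evR /ev.
case: i => [[|[|[|[|[|i]]]]] hi] //; case: j => [[|[|[|[|[|j]]]]] hj] //=;
  by rewrite ?ratQ_pos ?ratQ0 /Pos.to_nat /=; field.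
Qed.

Lemma coef2_exprE t tau u (y : 'rV[R]_5) (i j : 'I_5) :
  evR (env id t tau u (y 0 ip) (y 0 iq) (y 0 iz)) (coef2_expr i j) =
  gF_coef2 a4 a5 a6 y i j.
Proof.
rewrite /gF_coef2 -/c.
rewrite !(symprod_dcoordE, mxE) -!val_eqE /evR /ev.
case: i => [[|[|[|[|[|i]]]]] hi] //; case: j => [[|[|[|[|[|j]]]]] hj] //=;
  by rewrite ?ratQ_pos ?ratQ0 /Pos.to_nat /= ?sig2; field.
Qed.

End Environments.

(** * Ricci flatness and signature *)

Section RepresentedRicci.
Variables (R : realType) (A : lmodType R) (mul : A -> A -> A).
Variables (D : 'I_(5 + 1 + 1) -> A -> A) (rep : A -> expr -> Prop).
Hypotheses (rep0 : rep 0 '#0%X)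
  (repD : forall x y e f, rep x e -> rep y f -> rep (x + y) (e + f)%X)
  (repB : forall x y e f, rep x e -> rep y f -> rep (x - y) (e - f)%X)
  (repM : forall x y e f, rep x e -> rep y f -> rep (mul x y) (e * f)%X)
  (rep_half : forall x e, rep x e -> rep (2^-1 *: x) ((1 // 2) * e)%X)
  (rep_pd : forall (i : 'I_(5 + 1 + 1)) x e, rep x e -> rep (D i x) (pd i e))
  (rep_normalize : forall x e, rep x e -> rep x (normalize e)).

Lemma rep_sum n (F : 'I_n -> A) (f : nat -> expr) :
  (forall l, rep (F l) (f l)) -> rep (\sum_l F l) (sum_expr n f).
Proof.
elim: n F f => [|n IH] F f h; first by rewrite big_ord0.
rewrite big_ord_recl /sum_expr /=; apply: repD => //.
rewrite -[1%N]addn0 iotaDl foldr_map; exact: (IH _ (fun i => f i.+1)).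
Qed.

Lemma tbl_tab2 f (i j : 'I_(5 + 1 + 1)) : tbl (tab2 f) i j = normalize (f i j).
Proof. by rewrite /tbl /tab2 nth_mkseq ?nth_mkseq. Qed.

Lemma tbl3_tab3 f (i j k : 'I_(5 + 1 + 1)) :
  tbl3 (tab3 f) i j k = normalize (f i j k).
Proof. by rewrite /tbl3 /tab3 nth_mkseq // tbl_tab2. Qed.

(** A relation closed under the operations that occur in [ricci] carries the symbolic Ricci tensor
    along. One computation thus serves functions and formal series alike. *)
Lemma rep_ricci (g ginv : 'I_(5 + 1 + 1) -> 'I_(5 + 1 + 1) -> A) :
  (forall i j, rep (g i j) (metric_expr i j)) ->
  (forall i j, rep (ginv i j) (inverse_expr i j)) ->
  forall i j, rep (ricci mul D g ginv i j) (ricci_of (tbl3 christoffel_tab) i j).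
Proof.
move=> hg hginv.
have repG k i j : rep (christoffel mul D g ginv k i j) (tbl3 christoffel_tab k i j).
  rewrite tbl3_tab3; apply/rep_normalize/rep_half/rep_sum => l.
  rewrite tbl3_tab3; apply: repM; first by rewrite tbl_tab2; exact: rep_normalize.
  apply: rep_normalize; rewrite !tbl_tab2.
  apply: repB; last by apply/rep_pd/rep_normalize.
  by apply: repD; apply/rep_pd/rep_normalize.
move=> i j; apply: repD; apply: rep_sum => k.
  by apply: repB; exact: rep_pd.
by apply: rep_sum => l; apply: repB; exact: repM.
Qed.

End RepresentedRicci.

(** * Partial derivatives of the assignments *)

Lemma nth_positive (T : Type) (x0 : T) p (l : seq T) :
  BinList.nth x0 p l = nth x0 l (Pos.to_nat p).-1.
Proof.
have jumpE q : forall s : seq T, BinList.jump q s = drop (Pos.to_nat q) s.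
  elim: q => [q IH|q IH|] s /=; last by case: s => //= x s; rewrite drop0.
    rewrite Pos2Nat.inj_xI !IH drop_drop multE mulSn mul1n -drop_drop.
    by case: s => //= x s; rewrite drop_drop.
  by rewrite Pos2Nat.inj_xO !IH drop_drop multE mulSn mul1n.
rewrite -[l in LHS]/(List.tl (x0 :: l)) BinList.nth_jump jumpE.
rewrite -[LHS]/(List.hd x0 (drop (Pos.to_nat p) (x0 :: l))).
have -> (s : seq T) : List.hd x0 s = nth x0 s 0 by case: s.
by rewrite nth_drop addn0; have /ssrnat.ltP := Pos2Nat.is_pos p; case: (Pos.to_nat p).
Qed.

Lemma evP_dcoord (R : realType) (a0 a1 a2 a3 a4 a5 a6 b : R)
    (t tau u p q z : {poly R}) (i : nat) (x : positive) :
  evP (env a0 a1 a2 a3 a4 a5 a6 b polyC t tau u p q z) (dcoord_expr i x) =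
  nth 0 [:: (i == 5)%:R; - (i == 5)%:R * tau ^+ 2; (i == 6)%:R;
            (i == 2)%:R; (i == 3)%:R; (i == 4)%:R] (Pos.to_nat x).-1.
Proof.
have e1 : evP (env a0 a1 a2 a3 a4 a5 a6 b polyC t tau u p q z) '#1%X = 1.
  by rewrite /evP /ev /= ratQ1.
have e0 : evP (env a0 a1 a2 a3 a4 a5 a6 b polyC t tau u p q z) '#0%X = 0.
  by rewrite /evP /ev /= ratQ0.
rewrite /dcoord_expr; have /ssrnat.ltP := Pos2Nat.is_pos x.
case: (Pos.to_nat x) => // m _.
case: i => [|[|[|[|[|[|[|i]]]]]]]; case: m => [|[|[|[|[|[|m]]]]]];
  by rewrite ?e0 ?e1 //= ?mulNr ?mul0r ?oppr0 ?mul1r ?nth_nil.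
Qed.

Section EnvironmentDerivatives.
Variables (R : realType) (a0 a1 a2 a3 a4 a5 a6 b : R).
Variables (n : nat) (dom : set 'rV[R]_n) (i : 'I_n).
Variables t tau u p q z : 'rV[R]_n -> {poly R}.
Hypotheses
  (dt : has_partialP dom i t (fun=> (i == 5 :> nat)%:R))
  (dtau : has_partialP dom i tau (fun v => - (i == 5 :> nat)%:R * tau v ^+ 2))
  (du : has_partialP dom i u (fun=> (i == 6 :> nat)%:R))
  (dp : has_partialP dom i p (fun=> (i == 2 :> nat)%:R))
  (dq : has_partialP dom i q (fun=> (i == 3 :> nat)%:R))
  (dz : has_partialP dom i z (fun=> (i == 4 :> nat)%:R)).

Lemma env_has_partialP x :
  let l v := env a0 a1 a2 a3 a4 a5 a6 b polyC (t v) (tau v) (u v) (p v) (q v) (z v) in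
  has_partialP dom i (fun v => BinList.nth 0 x (l v))
    (fun v => evP (l v) (dcoord_expr i x)).
Proof.
move=> l.
apply: (@eq_has_partialP _ _ _ _ _ (fun v => nth 0 (l v) (Pos.to_nat x).-1) _
  (fun v => nth 0 [:: (i == 5 :> nat)%:R; - (i == 5 :> nat)%:R * tau v ^+ 2;
     (i == 6 :> nat)%:R; (i == 2 :> nat)%:R; (i == 3 :> nat)%:R;
     (i == 4 :> nat)%:R] (Pos.to_nat x).-1)).
- by move=> v; rewrite nth_positive.
- by move=> v; rewrite evP_dcoord.
case: (Pos.to_nat x).-1 => [|[|[|[|[|[|m]]]]]] //.
(* Past the six letters t, 1/t, u, p, q, z the list holds constants, so its tail may be computed
   with 0 in their place. *)
apply: (@eq_has_partialP _ _ _ _ _ (fun=> nth 0 (map polyC (drop 6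
    (env a0 a1 a2 a3 a4 a5 a6 b id 0 0 0 0 0 0))) m) _ (fun=> 0)) => [v|v|].
- by [].
- by rewrite /= nth_nil.
- exact: has_partialP_cst.
Qed.

End EnvironmentDerivatives.

Section CoordinateDerivatives.
Variables (R : realType) (n : nat) (dom : set 'rV[R]_n) (i : 'I_n).

Lemma has_partialP_C (f f' : 'rV[R]_n -> R) : has_partial dom i f f' ->
  has_partialP dom i (fun v => (f v)%:P) (fun v => (f' v)%:P).
Proof.
move=> h [|k].
  by apply: eq_has_partial h => v; rewrite coefC.
by apply: eq_has_partial (@has_partial_cst _ _ dom i 0) => v; rewrite coefC.
Qed.

Lemma has_partial_coord (j : 'I_n) :
  has_partial dom i (fun v => v 0 j) (fun=> (i == j)%:R).
Proof.
move=> v _; split; first exact: differentiable_coord.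
rewrite /partial deriveE; last exact: differentiable_coord.
have @f : {linear 'rV[R]_n -> R}.
  by exists (fun N : 'rV[R]_n => N 0 j); do 2![eexists]; do ?[constructor];
     rewrite ?mxE// => ? *; rewrite ?mxE//; move=> ?; rewrite !mxE.
rewrite (_ : (fun _ => _) = f) // diff_lin; last exact: coord_continuous.
by rewrite /= mxE eqxx eq_sym.
Qed.

Lemma has_partial_inv (f f' : 'rV[R]_n -> R) :
  (forall v, dom v -> f v != 0) -> has_partial dom i f f' ->
  has_partial dom i (fun v => (f v)^-1) (fun v => - f' v * (f v)^-1 ^+ 2).
Proof.
move=> f0 h v dv; have [df <-] := h v dv; have fv := f0 v dv.
split; first exact: differentiableV.
rewrite [LHS]deriveV //; last exact: diff_derivable.
by rewrite -[LHS]/(- (f v) ^- 2 * 'D_(delta_mx 0 i) f v) exprVn !mulNr mulrC.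
Qed.

Lemma open_coord_gt0 (j : 'I_n) : open [set v : 'rV[R]_n | 0 < v 0 j].
Proof.
apply: (@open_comp _ _ (fun v : 'rV[R]_n => v 0 j) [set x | 0 < x]).
  by move=> v _; exact: coord_continuous.
exact: open_gt.
Qed.

End CoordinateDerivatives.

Section AmbientEnvironments.
Variables (R : realType) (a0 a1 a2 a3 a4 a5 a6 b : R).

Local Notation n6 := (5 + 1)%N.
Local Notation n7 := (5 + 1 + 1)%N.
Local Notation env := (env a0 a1 a2 a3 a4 a5 a6 b).

Definition env7 (w : 'rV[R]_(5 + 1 + 1)) : seq R :=
  let y : 'rV[R]_5 := lsubmx (lsubmx w) in
  env id (w 0 it) (w 0 it)^-1 (w 0 iu) (y 0 ip) (y 0 iq) (y 0 iz).

(** With u as indeterminate, coefficient k of a value is the coefficient of u^k of a formal series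
    at a point of J x R_+. *)
Definition env6 (v : 'rV[R]_(5 + 1)) : seq {poly R} :=
  let y : 'rV[R]_5 := lsubmx v in
  env polyC (v 0 it1)%:P (v 0 it1)^-1%:P 'X (y 0 ip)%:P (y 0 iq)%:P (y 0 iz)%:P.

(* The metric g_F on J is the restriction of the coefficients to t = 1, u = 0. *)
Definition env5 (y : 'rV[R]_5) : seq R :=
  env id 1 1 0 (y 0 ip) (y 0 iq) (y 0 iz).

Lemma env7_admissible (w : 'rV[R]_n7) : 0 < w 0 it -> admissible (map polyC (env7 w)).
Proof. by move=> w0; apply: env_admissible; rewrite gt_eqF. Qed.

Lemma env6_admissible (v : 'rV[R]_n6) : 0 < v 0 it1 -> admissible (env6 v).
Proof. by move=> v0; apply: env_admissible; rewrite gt_eqF. Qed.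

Lemma env5_admissible y : admissible (map polyC (env5 y)).
Proof.
rewrite /env5 -[X in env id 1 X]invr1.
by apply: env_admissible; rewrite oner_eq0.
Qed.

Let dom7 := [set w : 'rV[R]_n7 | 0 < w 0 it].
Let dom6 := [set v : 'rV[R]_n6 | 0 < v 0 it1].

Let delta n (dom : set 'rV[R]_n) (i j : 'I_n) (k : nat) : j = k :> nat ->
  has_partialP dom i (fun v => (v 0 j)%:P) (fun=> (i == k :> nat)%:R).
Proof.
move=> jk; apply: eq_has_partialP (has_partialP_C (@has_partial_coord _ _ dom i j)).
  by [].
by move=> v; rewrite -val_eqE /= jk; case: (_ == _).
Qed.

(** Covers t and u on J, and u on J x R_+: they are not coordinates there but constants, and the
    Kronecker symbol vanishes because i < n <= k. *)
Let cst0 n (dom : set 'rV[R]_n) (i : 'I_n) (x : {poly R}) (k : nat) : (n <= k)%N ->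
  has_partialP dom i (fun=> x) (fun=> (i == k :> nat)%:R).
Proof.
move=> nk; apply: eq_has_partialP (has_partialP_cst i x) => // v.
by rewrite ltn_eqF // (leq_trans (ltn_ord i)).
Qed.

Lemma env7_has_partial (i : 'I_n7) e :
  has_partial dom7 i (fun w => evR (env7 w) e) (fun w => evR (env7 w) (pd i e)).
Proof.
suff h : has_partialP dom7 i (fun w => evP (map polyC (env7 w)) e)
    (fun w => evP (map polyC (env7 w)) (pd i e)).
  by apply: eq_has_partial (h 0) => w; rewrite evP_polyC coefC.
apply: has_partialP_evP; apply: env_has_partialP.
- exact: delta.
- apply: eq_has_partialP (has_partialP_C (has_partial_inv _
    (@has_partial_coord _ _ dom7 i it))) => [w|w|w] //.
    rewrite -val_eqE /= polyCM polyCN polyC_exp.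
    by congr (- _ * _); case: (_ == _).
  by move=> w0; rewrite gt_eqF.
- exact: delta.
- by under eq_fun do rewrite !mxE; exact: delta.
- by under eq_fun do rewrite !mxE; exact: delta.
- by under eq_fun do rewrite !mxE; exact: delta.
Qed.

Lemma env6_has_partialP (i : 'I_n6) e :
  has_partialP dom6 i (fun v => evP (env6 v) e) (fun v => evP (env6 v) (pd i e)).
Proof.
apply: has_partialP_evP; apply: env_has_partialP.
- exact: delta.
- apply: eq_has_partialP (has_partialP_C (has_partial_inv _
    (@has_partial_coord _ _ dom6 i it1))) => [w|w|w] //.
    rewrite -val_eqE /= polyCM polyCN polyC_exp.
    by congr (- _ * _); case: (_ == _).
  by move=> w0; rewrite gt_eqF.
- exact: cst0.
- by under eq_fun do rewrite !mxE; exact: delta.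
- by under eq_fun do rewrite !mxE; exact: delta.
- by under eq_fun do rewrite !mxE; exact: delta.
Qed.

Lemma env5_has_partial (i : 'I_5) e :
  has_partial setT i (fun y => evR (env5 y) e) (fun y => evR (env5 y) (pd i e)).
Proof.
suff h : has_partialP setT i (fun y => evP (map polyC (env5 y)) e)
    (fun y => evP (map polyC (env5 y)) (pd i e)).
  by apply: eq_has_partial (h 0) => w; rewrite evP_polyC coefC.
apply: has_partialP_evP; apply: env_has_partialP.
- exact: cst0.
- apply: eq_has_partialP (has_partialP_cst i 1) => // v.
  by rewrite ltn_eqF // oppr0 mul0r.
- exact: cst0.
- exact: delta.
- exact: delta.
- exact: delta.
Qed.

Lemma env6_deriv v e : (evP (env6 v) e)^`() = evP (env6 v) (pd 6 e).
Proof.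
apply: deriv_evP => p; rewrite evP_dcoord nth_positive.
case: (Pos.to_nat p).-1 => [|[|[|[|[|[|m]]]]]] /=; rewrite ?derivC ?oppr0 ?mul0r //.
  exact: derivX.
rewrite nth_nil -[X in nth 0 X m]/(map polyC (drop 6
    (env id 0 0 0 0 0 0))).
(* Eleven constants follow the six letters: c, sigma, rho, the seven a_i and b. *)
case: (ltnP m 11) => hm; first by rewrite (nth_map 0) // derivC.
by rewrite nth_default // deriv0.
Qed.

End AmbientEnvironments.

(** Functions given by expressions are closed under partial derivatives, so every iterated
    derivative is again one of them, hence differentiable. The index [i0] gives access to
    [has_partial], which is stated for one direction. *)
Lemma smooth_on_evR (R : realType) n (dom : set 'rV[R]_n) (i0 : 'I_n)
    (l : 'rV[R]_n -> seq R) (f : 'rV[R]_n -> R) (e : expr) :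
  open dom ->
  (forall i e, has_partial dom i (fun v => evR (l v) e) (fun v => evR (l v) (pd i e))) ->
  (forall v, dom v -> f v = evR (l v) e) -> smooth_on dom f.
Proof.
move=> odom hl fe s.
have [e' fse] : exists e', forall v, dom v -> foldr (@partial R n) f s v = evR (l v) e'.
  elim: s => [|i s [e' IH]]; first by exists e.
  exists (pd i e') => v dv /=.
  by rewrite (partial_eq_on odom _ IH) //; case: (hl i e' v dv).
move=> v dv; apply: (differentiable_eq_on odom (f := fun v => evR (l v) e')) => //.
  by move=> w /fse.
by case: (hl i0 e' v dv).
Qed.

Lemma evP_sum_expr (R : realType) (l : seq {poly R}) n (f : nat -> expr) :
  evP l (sum_expr n f) = \sum_(i < n) evP l (f i).
Proof.
rewrite /sum_expr -(big_mkord xpredT (fun i => evP l (f i))) /index_iota subn0.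
elim: (iota 0 n) => [|i s IH]; first by rewrite big_nil /evP /ev /= ratQ0.
by rewrite big_cons -IH.
Qed.

(** * The ambient metric on the half space t > 0 *)

Section AmbientRicci.
Variables (R : realType) (a0 a1 a2 a3 a4 a5 a6 b : R).

Local Notation n6 := (5 + 1)%N.
Local Notation n7 := (5 + 1 + 1)%N.
Local Notation env7 := (env7 a0 a1 a2 a3 a4 a5 a6 b).
Local Notation env6 := (env6 a0 a1 a2 a3 a4 a5 a6 b).
Local Notation env5 := (env5 a0 a1 a2 a3 a4 a5 a6 b).
Local Notation gF := (gF a0 a1 a2 a3 a4 a5 a6 b).
Local Notation tgF := (tgF a0 a1 a2 a3 a4 a5 a6 b).
Local Notation coef1 := (gF_coef1 a2 a3 a4 a5 a6 b).
Local Notation coef2 := (gF_coef2 a4 a5 a6).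

Lemma metric_expr_it (i : nat) :
  metric_expr it i = if i == 6 then (- '#1)%X else ('#0)%X.
Proof. by rewrite /metric_expr /= -(eqn_add2l 5 i 6). Qed.

Lemma metric_expr_iu (i : nat) :
  metric_expr iu i = if i == 5 then (- '#1)%X else ('#0)%X.
Proof. by rewrite /metric_expr /= -(eqn_add2l 6 i 5). Qed.

Lemma metric_exprC (i j : nat) : metric_expr i j = metric_expr j i.
Proof.
rewrite /metric_expr andbC addnC; case: ifP => // /andP[].
by case: i => [|[|[|[|[|i]]]]]; case: j => [|[|[|[|[|j]]]]].
Qed.

Lemma tgF_evR w (i j : 'I_n7) : tgF w i j = evR (env7 w) (metric_expr i j).
Proof.
have ev1 : evR (env7 w) (- '#1)%X = - 1 by rewrite /evR /ev /= ratQ1.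
have ev0 : evR (env7 w) ('#0)%X = 0 by rewrite /evR /ev /= ratQ0.
have tgFE : tgF w i j = w 0 it ^+ 2 * pull (gF (lsubmx (lsubmx w))) i j
    - 2 * (dcoord R it (.) dcoord R iu) i j
    - (2 * w 0 it * w 0 iu) * pull (coef1 (lsubmx (lsubmx w))) i j
    + w 0 iu ^+ 2 * pull (coef2 (lsubmx (lsubmx w))) i j.
  have entry (A B C E : 'M[R]_n7) x y z s k l :
    (x *: A - y *: B - z *: C + s *: E) k l =
    x * A k l - y * B k l - z * C k l + s * E k l by rewrite !mxE.
  exact: entry.
rewrite {}tgFE symprod_dcoordE.
have e0 := coef0_exprE a0 a1 a2 a3 a4 a5 a6 b (w 0 it) (w 0 it)^-1 (w 0 iu)
  (lsubmx (lsubmx w)).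
have e1 := coef1_exprE a0 a1 a2 a3 a4 a5 a6 b (w 0 it) (w 0 it)^-1 (w 0 iu)
  (lsubmx (lsubmx w)).
have e2 := coef2_exprE a0 a1 a2 a3 a4 a5 a6 b (w 0 it) (w 0 it)^-1 (w 0 iu)
  (lsubmx (lsubmx w)).
case: (ord7P i) => [[i' ->]| -> | ->]; case: (ord7P j) => [[j' ->]| -> | ->].
- rewrite !pull_lshift !lshift_it !lshift_iu /metric_expr /= !ltn_ord -e0 -e1 -e2.
  rewrite -[RHS]/(w 0 it ^+ 2 * evR (env7 w) (coef0_expr i' j')
    - ratQ R (Qmake 2 1) * w 0 it * w 0 iu * evR (env7 w) (coef1_expr i' j')
    + w 0 iu ^+ 2 * evR (env7 w) (coef2_expr i' j')).
  by rewrite ratQ_pos divr1 addr0 !mulr0 subr0.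
- rewrite !pull_it_r lshift_it lshift_iu.
  by rewrite metric_exprC metric_expr_it /= (ord5_eqF _ 1) ev0; field.
- rewrite !pull_iu_r lshift_it lshift_iu.
  by rewrite metric_exprC metric_expr_iu /= (ord5_eqF _ 0) ev0; field.
- rewrite !pull_it_l lshift_it lshift_iu it_iu andbF.
  by rewrite metric_expr_it /= (ord5_eqF _ 1) ev0; field.
- by rewrite !pull_it_l it_iu andbF andFb (_ : metric_expr it it = ('#0)%X) //
    ev0 ?mulr0n; field.
- by rewrite !pull_it_l it_iu !eqxx andFb (_ : metric_expr it iu = (- '#1)%X) //
    ev1 ?mulr0n ?mulr1n; field.
- rewrite !pull_iu_l lshift_it lshift_iu iu_it andbF.
  by rewrite metric_expr_iu /= (ord5_eqF _ 0) ev0; field.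
- by rewrite !pull_iu_l iu_it !eqxx andFb (_ : metric_expr iu it = (- '#1)%X) //
    ev1 ?mulr0n ?mulr1n; field.
- by rewrite !pull_iu_l iu_it andbF andFb (_ : metric_expr iu iu = ('#0)%X) //
    ev0 ?mulr0n; field.
Qed.

Lemma gF_evR y (i j : 'I_5) : gF y i j = evR (env5 y) (metric_expr i j).
Proof.
rewrite /metric_expr !ltn_ord /= -(coef0_exprE _ _ _ _ _ _ _ _ 1 1 0 y i j).
rewrite -[RHS]/(1 ^+ 2 * evR (env5 y) (coef0_expr i j)
  - ratQ R (Qmake 2 1) * 1 * 0 * evR (env5 y) (coef1_expr i j)
  + 0 ^+ 2 * evR (env5 y) (coef2_expr i j)).
by rewrite expr1n mul1r mulr0 mul0r subr0 expr2 !mul0r addr0.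
Qed.

Lemma gF_smooth i j : smooth_on setT (fun y => gF y i j).
Proof.
apply: (smooth_on_evR ip openT _ (fun y _ => gF_evR y i j)) => k e.
exact: env5_has_partial.
Qed.

Lemma tgF_smooth i j : smooth_on [set w : 'rV[R]_n7 | 0 < w 0 it] (fun w => tgF w i j).
Proof.
apply: (smooth_on_evR (l := env7) (e := metric_expr i j) it (@open_coord_gt0 R n7 it)).
  by move=> k e; exact: env7_has_partial.
by move=> w _; exact: tgF_evR.
Qed.

Let rep7 (f : 'rV[R]_n7 -> R^o) (e : expr) : Prop :=
  forall w : 'rV[R]_n7, 0 < w 0 it -> f w = evR (env7 w) e.

Let rep7_ricci (h : 'I_n7 -> 'I_n7 -> 'rV[R]_n7 -> R^o) :
  (forall i j, rep7 (h i j) (inverse_expr i j)) ->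
  forall i j, rep7 (ricci (fun f h w => f w * h w) (@partial R n7)
    (fun k l w => tgF w k l) h i j) (ricci_of (tbl3 christoffel_tab) i j).
Proof.
move=> hh; apply: rep_ricci => //.
- by move=> w _; rewrite /evR /ev /= ratQ0.
- by move=> x y e f hx hy w w0; rewrite -[LHS]/(x w + y w) hx ?hy.
- by move=> x y e f hx hy w w0; rewrite -[LHS]/(x w - y w) hx ?hy.
- by move=> x y e f hx hy w w0; rewrite hx ?hy.
- move=> x e hx w w0; rewrite -[LHS]/(2^-1 * x w) hx //.
  rewrite -[RHS]/(ratQ R (Qmake 1 2) * evR (env7 w) e).
  by rewrite ratQ_pos mul1r.
- move=> i x e hx w w0; rewrite (partial_eq_on (@open_coord_gt0 R n7 it) i hx w0).
  by case: (env7_has_partial a0 a1 a2 a3 a4 a5 a6 b i e w0).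
- move=> x e hx w w0; rewrite hx //; apply: (polyC_inj (R := R)).
  by rewrite -!evP_polyC evP_normalize //; exact: env7_admissible.
- by move=> i j w _; rewrite tgF_evR.
Qed.

Definition tgF_inverse (w : 'rV[R]_n7) : 'M[R]_n7 :=
  \matrix_(i, j) evR (env7 w) (inverse_expr i j).

Lemma evP_inverse (l : seq {poly R}) (i j : 'I_n7) : admissible l ->
  \sum_(k < n7) evP l (metric_expr i k) * evP l (inverse_expr k j) = (i == j)%:R.
Proof.
move=> hl; have := evP_is_zero hl (for_all2P metric_inverse_check (ltn_ord i) (ltn_ord j)).
have evB e f : evP l (e - f)%X = evP l e - evP l f by [].
rewrite evB evP_sum_expr => /eqP; rewrite subr_eq0 => /eqP ->.
rewrite -val_eqE /=.
by case: (nat_of_ord i == j); rewrite /evP /ev /= ?ratQ0 ?ratQ1.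
Qed.

Lemma evR_inverse (w : 'rV[R]_n7) (i j : 'I_n7) : 0 < w 0 it ->
  \sum_(k < n7) evR (env7 w) (metric_expr i k) * evR (env7 w) (inverse_expr k j)
  = (i == j)%:R.
Proof.
move=> w0; apply: (polyC_inj (R := R)).
rewrite rmorph_sum /= rmorph_nat -(evP_inverse i j (l := map polyC (env7 w))).
  by apply: eq_bigr => k _; rewrite polyCM !evP_polyC.
exact: env7_admissible.
Qed.

Lemma invmx_tgF (w : 'rV[R]_n7) : 0 < w 0 it -> invmx (tgF w) = tgF_inverse w.
Proof.
move=> w0; have e : tgF w *m tgF_inverse w = 1%:M.
  apply/matrixP => i j; rewrite !mxE -(evR_inverse i j w0).
  by apply: eq_bigr => k _; rewrite tgF_evR mxE.
have [u _] := mulmx1_unit e.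
by rewrite -[LHS]mulmx1 -e mulKmx.
Qed.

Lemma ricci_tgF (w : 'rV[R]_n7) : 0 < w 0 it -> ricci_tensor tgF w = 0.
Proof.
move=> w0; apply/matrixP => i j; rewrite !mxE rep7_ricci //.
  apply: evR_is_zero; first exact: env7_admissible.
  exact: (@for_all2P 7 (fun k l => is_zero (ricci_of (tbl3 christoffel_tab) k l))
    ricci_check i j (ltn_ord i) (ltn_ord j)).
by move=> k l v v0; rewrite invmx_tgF // mxE.
Qed.

End AmbientRicci.

(** * Signatures from explicit frames *)

Lemma has_signature_of_frame (R : realType) n (B P : 'M[R]_n) (p q : nat) :
  B^T = B -> (p + q)%N = n ->
  P *m B *m P^T = diag_mx (\row_i (if (i < p)%N then 1 else -1)) ->
  has_signature B p q.
Proof.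
move=> symB pq PBP; split=> //; exists P => //.
set d := diag_mx _ in PBP.
have dd : d *m d = 1%:M.
  rewrite /d mulmx_diag; apply/matrixP => i j; rewrite !mxE.
  by case: (i < p)%N; rewrite ?mulrNN mulr1.
(* A diagonal matrix of signs is its own inverse, so [P] has a right inverse and is invertible. *)
have e : P *m (B *m P^T *m d) = 1%:M by rewrite !mulmxA PBP dd.
by case: (mulmx1_unit e).
Qed.

Section AmbientSignature.
Variables (R : realType) (a0 a1 a2 a3 a4 a5 a6 b : R).

Local Notation n6 := (5 + 1)%N.
Local Notation n7 := (5 + 1 + 1)%N.
Local Notation env7 := (env7 a0 a1 a2 a3 a4 a5 a6 b).
Local Notation env6 := (env6 a0 a1 a2 a3 a4 a5 a6 b).
Local Notation env5 := (env5 a0 a1 a2 a3 a4 a5 a6 b).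
Local Notation gF := (gF a0 a1 a2 a3 a4 a5 a6 b).
Local Notation tgF := (tgF a0 a1 a2 a3 a4 a5 a6 b).
Local Notation coef1 := (gF_coef1 a2 a3 a4 a5 a6 b).
Local Notation coef2 := (gF_coef2 a4 a5 a6).

Let frame_gram n (l : seq R) (s : bool) (a c : nat) :
  admissible (map polyC l) ->
  is_zero (sum_expr n (fun k => sum_expr n (fun m =>
     orthonormal_frame a k * metric_expr k m * orthonormal_frame c m))
   - (if a == c then if s then '#1 else - '#1 else '#0))%X ->
  \sum_(m < n) (\sum_(k < n) evR l (orthonormal_frame a k) * evR l (metric_expr k m))
     * evR l (orthonormal_frame c m) = (a == c)%:R * (if s then 1 else - 1).
Proof.
move=> hl /(evP_is_zero hl).
have evB e f : evP (map polyC l) (e - f)%X = evP (map polyC l) e - evP (map polyC l) f by [].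
have evM e f : evP (map polyC l) (e * f)%X = evP (map polyC l) e * evP (map polyC l) f by [].
have evN e : evP (map polyC l) (- e)%X = - evP (map polyC l) e by [].
have ev1 : evP (map polyC l) ('#1)%X = 1 by rewrite /evP /ev /= ratQ1.
have ev0 : evP (map polyC l) ('#0)%X = 0 by rewrite /evP /ev /= ratQ0.
rewrite evB evP_sum_expr => /eqP; rewrite subr_eq0 => /eqP e.
apply: (polyC_inj (R := R)); rewrite rmorph_sum /=.
transitivity (\sum_(i < n) evP (map polyC l) (sum_expr n (fun m =>
     orthonormal_frame a i * metric_expr i m * orthonormal_frame c m)%X)).
  under [RHS]eq_bigr do rewrite evP_sum_expr.
  rewrite [RHS]exchange_big /=; apply: eq_bigr => m _.
  rewrite polyCM rmorph_sum mulr_suml; apply: eq_bigr => k _.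
  by rewrite /= polyCM !evP_polyC.
apply: (etrans e) => {e}; case: (a == c); rewrite ?mul0r ?mul1r //.
by case: s; rewrite ?evN ev1 ?polyCN.
Qed.

Lemma tgF_tr w : (tgF w)^T = tgF w.
Proof.
apply/matrixP => i j; rewrite mxE !tgF_evR.
by congr (evR _ _); exact: metric_exprC.
Qed.

Lemma gF_tr y : (gF y)^T = gF y.
Proof.
apply/matrixP => i j; rewrite mxE !gF_evR.
by congr (evR _ _); exact: metric_exprC.
Qed.

Lemma gF_signature y : has_signature (gF y) 3 2.
Proof.
apply: (@has_signature_of_frame R 5 _
  (\matrix_(a, k) evR (env5 y) (orthonormal_frame a k))) => //.
  exact: gF_tr.
apply/matrixP => a c; rewrite !mxE.
have := frame_gram (s := (a < 3)%N) (env5_admissible a0 a1 a2 a3 a4 a5 a6 b y)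
  (for_all2P frame5_check (ltn_ord a) (ltn_ord c)).
rewrite mulr_natl => <-; apply: eq_bigr => m _; rewrite !mxE; congr (_ * _).
by apply: eq_bigr => k _; rewrite mxE gF_evR.
Qed.

(* Reorders the frame of the 7-dimensional metric so that the vectors of
   positive norm come first. *)
Let sorted_index (a : nat) : nat := nth 0 [:: 0; 1; 2; 5; 3; 4; 6]%N a.

Lemma tgF_signature (w : 'rV[R]_n7) : 0 < w 0 it -> has_signature (tgF w) 4 3.
Proof.
move=> w0; apply: (@has_signature_of_frame R n7 _
  (\matrix_(a, k) evR (env7 w) (orthonormal_frame (sorted_index a) k))) => //.
  exact: tgF_tr.
apply/matrixP => a c; rewrite !mxE.
have lt7 (i : 'I_n7) : (sorted_index i < 7)%N.
  by case: i => [[|[|[|[|[|[|[|i]]]]]]] hi].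
have := frame_gram (s := (sorted_index a < 3)%N || (sorted_index a == 5))
  (env7_admissible a0 a1 a2 a3 a4 a5 a6 b w0)
  (for_all2P frame_check (lt7 a) (lt7 c)).
have -> : (sorted_index a == sorted_index c) = (a == c).
  by case: a c => [[|[|[|[|[|[|[|i]]]]]]] hi] // [[|[|[|[|[|[|[|j]]]]]]] hj].
have -> : (sorted_index a < 3)%N || (sorted_index a == 5) = (a < 4)%N.
  by case: a => [[|[|[|[|[|[|[|i]]]]]]] hi].
rewrite mulr_natl => <-; apply: eq_bigr => m _; rewrite !mxE; congr (_ * _).
by apply: eq_bigr => k _; rewrite mxE tgF_evR.
Qed.

End AmbientSignature.

(** * The ambient metric as a formal series in u *)

Section AmbientSeries.
Variables (R : realType) (a0 a1 a2 a3 a4 a5 a6 b : R).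

Local Notation n6 := (5 + 1)%N.
Local Notation n7 := (5 + 1 + 1)%N.
Local Notation env7 := (env7 a0 a1 a2 a3 a4 a5 a6 b).
Local Notation env6 := (env6 a0 a1 a2 a3 a4 a5 a6 b).
Local Notation env5 := (env5 a0 a1 a2 a3 a4 a5 a6 b).
Local Notation gF := (gF a0 a1 a2 a3 a4 a5 a6 b).
Local Notation tgF := (tgF a0 a1 a2 a3 a4 a5 a6 b).
Local Notation coef1 := (gF_coef1 a2 a3 a4 a5 a6 b).
Local Notation coef2 := (gF_coef2 a4 a5 a6).

(** Matching -2 t u [...] with - u t alpha gives alpha = 2 [coef1]; the series stops at u^2. *)
Definition tgF_series : formal_form R :=
  ambient_series gF (fun y => 2 *: coef1 y) coef2 (fun=> 0) (fun _ _ => 0).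

Let rep6 (a : nat -> 'rV[R]_n6 -> R^o) (e : expr) : Prop :=
  forall k (v : 'rV[R]_n6), 0 < v 0 it1 -> a k v = (evP (env6 v) e)`_k.

Lemma rep6_ricci (g h : 'I_n7 -> 'I_n7 -> nat -> 'rV[R]_n6 -> R^o) :
  (forall i j, rep6 (g i j) (metric_expr i j)) ->
  (forall i j, rep6 (h i j) (inverse_expr i j)) ->
  forall i j, rep6 (ricci (@formal_mul R) (@formal_partial R) g h i j)
    (ricci_of (tbl3 christoffel_tab) i j).
Proof.
apply: rep_ricci => //.
- by move=> k v _; rewrite /evP /ev /= ratQ0 coef0.
- move=> x y e f hx hy k v v0; rewrite -[LHS]/(x k v + y k v) hx ?hy //.
  by rewrite -coefD.
- move=> x y e f hx hy k v v0; rewrite -[LHS]/(x k v - y k v) hx ?hy //.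
  by rewrite -coefB.
- move=> x y e f hx hy k v v0.
  have -> : evP (env6 v) (e * f)%X = evP (env6 v) e * evP (env6 v) f by [].
  rewrite coefM /formal_mul.
  by apply: eq_bigr => i _; rewrite hx ?hy.
- move=> x e hx k v v0; rewrite -[LHS]/(2^-1 * x k v) hx //.
  have -> : evP (env6 v) ((1 // 2) * e)%X = (ratQ R (Qmake 1 2))%:P * evP (env6 v) e by [].
  by rewrite ratQ_pos mul1r coefCM.
- move=> i x e hx k v v0; rewrite /formal_partial.
  case: (splitP i) => j ij.
    rewrite ij (partial_eq_on (@open_coord_gt0 R n6 it1) j (hx k) v0).
    by case: (env6_has_partialP a0 a1 a2 a3 a4 a5 a6 b j e k v0).
  have -> : pd i e = pd 6 e by rewrite ij (ord1 j).
  by rewrite -env6_deriv coef_deriv hx // mulr_natl.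
- by move=> x e hx k v v0; rewrite hx // evP_normalize //; exact: env6_admissible.
Qed.

(** The coefficient expressions do not contain u, so ['X] may be replaced by 0, after which all
    letters are constants. The second premise records this replacement and is settled by computation
    entry by entry. *)
Let evP6_const (c : nat -> nat -> expr) (f : 'rV[R]_5 -> 'M[R]_5) v (i j : 'I_5) :
  (forall (t tau u : R) (y : 'rV[R]_5) (i j : 'I_5),
     evR (env a0 a1 a2 a3 a4 a5 a6 b id t tau u (y 0 ip) (y 0 iq) (y 0 iz)) (c i j)
     = f y i j) ->
  evP (env6 v) (c i j) = evP (map polyC (env a0 a1 a2 a3 a4 a5 a6 b id (v 0 it1)
    (v 0 it1)^-1 0 ((lsubmx v) 0 ip) ((lsubmx v) 0 iq) ((lsubmx v) 0 iz))) (c i j) ->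
  evP (env6 v) (c i j) = (f (lsubmx v) i j)%:P.
Proof. by move=> h ->; rewrite evP_polyC h. Qed.

Let evP6_coef0 v (i j : 'I_5) :
  evP (env6 v) (coef0_expr i j) = (gF (lsubmx v) i j)%:P.
Proof.
apply: evP6_const => [t tau u y k l|]; first exact: coef0_exprE.
by case: i => [[|[|[|[|[|i]]]]] hi] //; case: j => [[|[|[|[|[|j]]]]] hj].
Qed.

Let evP6_coef1 v (i j : 'I_5) :
  evP (env6 v) (coef1_expr i j) = (coef1 (lsubmx v) i j)%:P.
Proof.
apply: evP6_const => [t tau u y k l|]; first exact: coef1_exprE.
by case: i => [[|[|[|[|[|i]]]]] hi] //; case: j => [[|[|[|[|[|j]]]]] hj].
Qed.

Let evP6_coef2 v (i j : 'I_5) :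
  evP (env6 v) (coef2_expr i j) = (coef2 (lsubmx v) i j)%:P.
Proof.
apply: evP6_const => [t tau u y k l|]; first exact: coef2_exprE.
by case: i => [[|[|[|[|[|i]]]]] hi] //; case: j => [[|[|[|[|[|j]]]]] hj].
Qed.

Lemma tgF_series_evP i j : rep6 (fun k v => tgF_series k v i j) (metric_expr i j).
Proof.
move=> k v _.
have ev1 : evP (env6 v) (- '#1)%X = (- 1)%:P by rewrite /evP /ev /= ratQ1 polyCN.
have ev0 : evP (env6 v) ('#0)%X = 0 by rewrite /evP /ev /= ratQ0.
have entry (A B : 'M[R]_n7) x y :
    (x *: A + y *: B) i j = x * A i j + y * B i j by rewrite !mxE.
have entryZ (A : 'M[R]_n7) x : (x *: A) i j = x * A i j by rewrite mxE.
have seriesE : tgF_series k v i j =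
  (if k == 0%N
     then - 2 * (2^-1 * (((i == it) && (j == iu))%:R + ((i == iu) && (j == it))%:R))
     + v 0 it1 ^+ 2 * pull (gF (lsubmx v)) i j else 0)
  - (if k == 1%N then 2 * v 0 it1 * pull (coef1 (lsubmx v)) i j else 0)
  + (if k == 2 then pull (coef2 (lsubmx v)) i j else 0).
  case: k => [|[|[|[|k]]]] /=; rewrite ?addr0 ?subr0 ?oppr0 ?add0r.
  - by rewrite entry // symprod_dcoordE.
  - by rewrite pullZ !entryZ; ring.
  - by [].
  - by rewrite pull0 scaler0 mxE.
  - by rewrite pull0 scaler0 mxE.
rewrite {}seriesE.
case: (ord7P i) => [[i' ->]| -> | ->]; case: (ord7P j) => [[j' ->]| -> | ->].
- rewrite !pull_lshift !lshift_it !lshift_iu /metric_expr /= !ltn_ord.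
  have -> : evP (env6 v) (xt ^ 2 * coef0_expr i' j' - '#2 * xt * xu * coef1_expr i' j'
      + xu ^ 2 * coef2_expr i' j')%X =
    (v 0 it1)%:P ^+ 2 * evP (env6 v) (coef0_expr i' j')
    - (ratQ R (Qmake 2 1))%:P * (v 0 it1)%:P * 'X * evP (env6 v) (coef1_expr i' j')
    + 'X ^+ 2 * evP (env6 v) (coef2_expr i' j') by [].
  rewrite evP6_coef0 evP6_coef1 evP6_coef2 ratQ_pos divr1 -polyC_exp -!polyCM.
  have coefX1 (x y : R) : (x%:P * 'X * y%:P)`_k = x * y * (k == 1%N)%:R.
    by rewrite mulrAC -polyCM coefCM coefX.
  have coefX2 (y : R) : ('X ^+ 2 * y%:P)`_k = y * (k == 2)%:R.
    by rewrite mulrC coefCM coefXn.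
  rewrite {ev0 ev1} coefD coefB coefC {}coefX1 {}coefX2.
  by rewrite /Pos.to_nat; case: k => [|[|[|k]]] /=; ring.
- rewrite !pull_it_r lshift_it lshift_iu.
  rewrite metric_exprC metric_expr_it /= (ord5_eqF _ 1) ev0 coef0.
  by case: eqP => _; case: eqP => _; case: eqP => _; ring.
- rewrite !pull_iu_r lshift_it lshift_iu.
  rewrite metric_exprC metric_expr_iu /= (ord5_eqF _ 0) ev0 coef0.
  by case: eqP => _; case: eqP => _; case: eqP => _; ring.
- rewrite !pull_it_l lshift_it lshift_iu it_iu andbF.
  rewrite metric_expr_it /= (ord5_eqF _ 1) ev0 coef0.
  by case: eqP => _; case: eqP => _; case: eqP => _; ring.
- rewrite !pull_it_l it_iu andbF andFb (_ : metric_expr it it = ('#0)%X) // ev0 coef0.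
  by case: eqP => _; case: eqP => _; case: eqP => _; rewrite ?mulr0n; ring.
- rewrite !pull_it_l it_iu !eqxx andFb (_ : metric_expr it iu = (- '#1)%X) // ev1 coefC.
  by case: k => [|[|[|k]]]; rewrite /= ?mulr0n ?mulr1n; field.
- rewrite !pull_iu_l lshift_it lshift_iu iu_it andbF.
  rewrite metric_expr_iu /= (ord5_eqF _ 0) ev0 coef0.
  by case: eqP => _; case: eqP => _; case: eqP => _; ring.
- rewrite !pull_iu_l iu_it !eqxx andFb (_ : metric_expr iu it = (- '#1)%X) // ev1 coefC.
  by case: k => [|[|[|k]]]; rewrite /= ?mulr0n ?mulr1n; field.
- rewrite !pull_iu_l iu_it andbF andFb (_ : metric_expr iu iu = ('#0)%X) // ev0 coef0.
  by case: eqP => _; case: eqP => _; case: eqP => _; rewrite ?mulr0n; ring.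
Qed.

Lemma tgF_series_ricci_flat : formal_ricci_flat tgF_series.
Proof.
exists (fun k v => \matrix_(i, j) (evP (env6 v) (inverse_expr i j))`_k).
  move=> i j k v v0; transitivity ((i == j)%:R : {poly R})`_k.
    rewrite -(evP_inverse i j (l := env6 v)); last exact: env6_admissible.
    rewrite coef_sum; apply: eq_bigr => l _; rewrite coefM /formal_mul.
    by apply: eq_bigr => m _; rewrite tgF_series_evP // mxE.
  by rewrite -polyC_natr coefC; case: k => [|k].
move=> i j k v v0; rewrite rep6_ricci //.
- rewrite evP_is_zero ?coef0 //; first exact: env6_admissible.
  exact: (@for_all2P 7 (fun k l => is_zero (ricci_of (tbl3 christoffel_tab) k l))
    ricci_check i j (ltn_ord i) (ltn_ord j)).
- exact: tgF_series_evP.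
- by move=> r s m w w0; rewrite mxE.
Qed.

Let tr_of (c : nat -> nat -> expr) (f : 'rV[R]_5 -> 'M[R]_5) :
  (forall y i j, f y i j = evR (env5 y) (c i j)) ->
  (forall i j : 'I_5, c i j = c j i) -> symmetric_tensor f.
Proof.
move=> fE cC; split=> [y|i j].
  by apply/matrixP => i j; rewrite mxE !fE cC.
apply: (smooth_on_evR (l := env5) (e := c i j) ip openT) => [k e|y _].
  exact: env5_has_partial.
exact: fE.
Qed.

Lemma tgF_series_has_ambient_form : has_ambient_form gF tgF_series.
Proof.
have sym0 : symmetric_tensor (fun=> 0 : 'M[R]_5).
  apply: (@tr_of (fun _ _ => ('#0)%X)) => // y i j.
  by rewrite mxE /evR /ev /= ratQ0.
exists (fun y => 2 *: coef1 y), coef2, (fun=> 0), (fun _ _ => 0); split=> //.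
  apply: (@tr_of (fun i j => ('#2 * coef1_expr i j)%X)).
    move=> y i j; rewrite mxE -(coef1_exprE a0 a1 _ _ _ _ _ _ 1 1 0 y).
    by rewrite -[RHS]/(ratQ R (Qmake 2 1) * _) ratQ_pos divr1.
  by case=> [[|[|[|[|[|i]]]]] hi] // [[|[|[|[|[|j]]]]] hj].
apply: (@tr_of coef2_expr) => [y i j|].
  by rewrite -(coef2_exprE a0 a1 a2 a3 _ _ _ b 1 1 0 y).
by case=> [[|[|[|[|[|i]]]]] hi] // [[|[|[|[|[|j]]]]] hj].
Qed.

(** The sum is a polynomial of degree at most 2 in u, so partial sums with at least three terms are
    all equal to it. *)
Lemma tgF_series_cvg (w : 'rV[R]_n7) i j : 0 < w 0 it ->
  series (fun k => w 0 iu ^+ k * tgF_series k (lsubmx w) i j) @ \oo --> tgF w i j.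
Proof.
move=> w0; have v0 : 0 < (lsubmx w) 0 it1 by rewrite mxE.
pose p := evP (env6 (lsubmx w)) (metric_expr i j).
have pE k : p`_k = tgF_series k (lsubmx w) i j by rewrite tgF_series_evP.
have sp : (size p <= 3)%N.
  apply/leq_sizeP => -[|[|[|[|k]]]] // _; by rewrite pE /tgF_series /= pull0 scaler0 mxE.
have horner_p : p.[w 0 iu] = tgF w i j.
  rewrite horner_evP tgF_evR; congr (evR _ _).
  by rewrite /= /env6 /env7 /env /= !hornerC hornerX !mxE.
rewrite -horner_p; apply: cvg_near_cst.
near=> n; rewrite /series /= (@horner_coef_wide _ n).
  rewrite big_mkord; apply: eq_bigr => k _.
  by rewrite pE mulrC.
by apply: leq_trans sp _; near: n; exact: nbhs_infty_ge.
Unshelve. all: by end_near. Qed.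

End AmbientSeries.

(** * Uniqueness of the ambient series *)

Section FormalCalculus.
Variable R : realType.
Local Notation n6 := (5 + 1)%N.
Local Notation n7 := (5 + 1 + 1)%N.
Local Notation F := (nat -> 'rV[R]_n6 -> R^o).

Definition eq_upto (m : nat) (a a' : F) : Prop :=
  forall k (v : 'rV[R]_n6), (k < m)%N -> 0 < v 0 it1 -> a' k v = a k v.

Lemma eq_upto_leq m m' a a' : (m' <= m)%N -> eq_upto m a a' -> eq_upto m' a a'.
Proof. by move=> mm h k v km; apply: h; exact: leq_trans km mm. Qed.

Lemma sum_formalE (I : finType) (f : I -> F) k v :
  (\sum_i f i) k v = \sum_i f i k v.
Proof. exact: (big_morph (fun a : F => a k v)). Qed.

Lemma formal_partial_lshift (j : 'I_n6) (a : F) k v :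
  formal_partial (lshift 1 j) a k v = partial j (a k) v.
Proof. by rewrite /formal_partial (unsplitK (inl j)). Qed.

Lemma formal_partial_iu (a : F) k v :
  formal_partial iu a k v = k.+1%:R * a k.+1 v.
Proof. by rewrite /formal_partial (unsplitK (inr ord0)). Qed.

Lemma ord_caseP (i : 'I_n7) : (exists j : 'I_n6, i = lshift 1 j) \/ i = iu.
Proof.
case: (ord7P i) => [[i' ->]| -> | ->]; [left|left|by right].
  by exists (lshift 1 i').
by exists it1.
Qed.

(** Derivatives in the other coordinates act on coefficient m alone; only the derivative in u shifts
    the index and reaches the first coefficient at which the series may differ. *)
Lemma formal_partial_diff i m a a' (v : 'rV[R]_n6) :
  eq_upto m.+1 a a' -> 0 < v 0 it1 ->
  formal_partial i a' m v - formal_partial i a m v =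
  (i == iu)%:R * (m.+1%:R * (a' m.+1 v - a m.+1 v)).
Proof.
move=> h v0; case: (ord_caseP i) => [[j ->]| ->].
  rewrite !formal_partial_lshift.
  rewrite (partial_eq_on (@open_coord_gt0 R n6 it1) j (f := a' m) (g := a m)) //.
    rewrite subrr; case: eqP => [|_]; last by rewrite mul0r.
    by move=> /(congr1 val) /= jE; have := ltn_ord j; rewrite jE.
  by move=> w w0; exact: h.
by rewrite !formal_partial_iu eqxx mul1r mulrBr.
Qed.

Lemma eq_upto_partial_lshift (j : 'I_n6) m a a' : eq_upto m a a' ->
  eq_upto m (formal_partial (lshift 1 j) a) (formal_partial (lshift 1 j) a').
Proof.
move=> h k v km v0; rewrite !formal_partial_lshift.
by apply: (partial_eq_on (@open_coord_gt0 R n6 it1)) => // w w0; exact: h.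
Qed.

Lemma eq_upto_partial i m a a' : eq_upto m.+1 a a' ->
  eq_upto m (formal_partial i a) (formal_partial i a').
Proof.
move=> h k v km v0; apply/eqP; rewrite -subr_eq0 formal_partial_diff //.
  by rewrite h ?ltnS // subrr !mulr0.
by apply: eq_upto_leq h; rewrite ltnS ltnW.
Qed.

Lemma eq_upto_mul m a a' b b' : eq_upto m a a' -> eq_upto m b b' ->
  eq_upto m (formal_mul a b) (formal_mul a' b').
Proof.
move=> ha hb k v km v0; apply: eq_bigr => i _; congr (_ * _).
  by apply: ha => //; exact: leq_trans km.
by apply: hb => //; apply: leq_ltn_trans km; exact: leq_subr.
Qed.

(** Below order m all coefficients agree, so only the two end terms of the convolution change. For m
    = 0 the ends coincide and a second-order term appears. *)
Lemma formal_mul_diff m a a' b b' (v : 'rV[R]_n6) :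
  eq_upto m a a' -> eq_upto m b b' -> 0 < v 0 it1 ->
  formal_mul a' b' m v - formal_mul a b m v =
  a 0%N v * (b' m v - b m v) + (a' m v - a m v) * b 0%N v
  + (m == 0%N)%:R * ((a' m v - a m v) * (b' m v - b m v)).
Proof.
move=> ha hb v0; case: m ha hb => [|m] ha hb.
  have aux (x y z w : R) :
    x * y - z * w = z * (y - w) + (x - z) * w + 1 * ((x - z) * (y - w)) by ring.
  by rewrite /formal_mul !big_ord1; exact: aux.
have aux (x y z w s p q : R) :
    x * y + (s + z * p) - (x * w + (s + q * p)) =
    x * (y - w) + (z - q) * p + 0 * ((z - q) * (y - w)) by ring.
rewrite /formal_mul big_ord_recl big_ord_recr /= [X in _ - X]big_ord_recl big_ord_recr /=.
rewrite !subn0 /bump !leq0n !add1n !subnn.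
rewrite (eq_bigr (fun i : 'I_m => a i.+1 v * b (m.+1 - i.+1)%N v)) => [|i _].
  by rewrite (ha 0%N) // (hb 0%N) //; exact: aux.
rewrite ha ?ltnS // hb //.
by rewrite subSS ltnS; exact: leq_subr.
Qed.

Lemma formal_mul_const a b (x : R) (v : 'rV[R]_n6) k :
  (forall m, a m v = (m == 0%N)%:R * x) -> formal_mul a b k v = x * b k v.
Proof.
move=> h; rewrite /formal_mul big_ord_recl h mul1r subn0 big1 ?addr0 // => i _.
by rewrite h mul0r mul0r.
Qed.

End FormalCalculus.

Lemma sum_ord7 (V : nmodType) (f : 'I_(5 + 1 + 1) -> V) :
  \sum_i f i = \sum_(a < 5) f (lshift 1 (lshift 1 a)) + f it + f iu.
Proof. by rewrite big_split_ord big_ord1 big_split_ord big_ord1. Qed.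

(** * Series of ambient form, homogeneous in t *)

Section NormalForm.
Variable R : realType.
Local Notation n6 := (5 + 1)%N.
Local Notation n7 := (5 + 1 + 1)%N.
Local Notation F := (nat -> 'rV[R]_n6 -> R^o).
Local Notation sp a := (lshift 1 (lshift 1 a)).

(** Replaces the five cases of [ambient_series] by one rule, t^(2-k) times a form on J, the sign of
    alpha being absorbed in c_1. The rows of t and u are fixed once and for all. *)
Record normal_form (S : formal_form R) (c : nat -> 'rV[R]_5 -> 'M[R]_5) : Prop := {
  normal_it : forall k (v : 'rV[R]_n6) j, 0 < v 0 it1 ->
    S k v it j = (k == 0%N)%:R * - (j == iu)%:R;
  normal_iu : forall k (v : 'rV[R]_n6) j, 0 < v 0 it1 ->
    S k v iu j = (k == 0%N)%:R * - (j == it)%:R;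
  normal_sym : forall k (v : 'rV[R]_n6) i j, 0 < v 0 it1 -> S k v i j = S k v j i;
  normal_sp : forall k (v : 'rV[R]_n6) (i j : 'I_5), 0 < v 0 it1 ->
    S k v (sp i) (sp j) = v 0 it1 ^ (2 - k%:Z) * c k (lsubmx v) i j
}.

Lemma has_ambient_form_normal g S : (forall y, (g y)^T = g y) ->
  has_ambient_form g S -> exists2 c, normal_form S c & c 0%N = g.
Proof.
move=> gT [al [be [ga [mu [[alT _] [beT _] [gaT _] muT SE]]]]].
pose c k := match k with
  | 0 => g | 1 => fun y => - al y | 2 => be | 3 => ga | k' => mu k' end.
have cT k y : (c k y)^T = c k y.
  case: k => [|[|[|[|k]]]] //=; first by rewrite linearN /= alT.
  by case: (muT k.+4).
have entryZ (A : 'M[R]_n7) (x : R) i j : (x *: A) i j = x * A i j by rewrite mxE.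
have {}SE k (v : 'rV[R]_n6) i j : 0 < v 0 it1 -> S k v i j =
    (k == 0%N)%:R * - (((i == it) && (j == iu))%:R + ((i == iu) && (j == it))%:R)
    + v 0 it1 ^ (2 - k%:Z) * pull (c k (lsubmx v)) i j.
  move=> v0; rewrite SE //; case: k => [|[|[|[|k]]]].
  - have -> (A B : 'M[R]_n7) (x y : R) : (x *: A + y *: B) i j = x * A i j + y * B i j.
      by rewrite !mxE.
    rewrite symprod_dcoordE mul1r; by congr (_ + _); field.
  - rewrite mul0r add0r -[c 1%N _]scaleN1r pullZ.
    by rewrite !entryZ mulN1r mulrN mulNr.
  - by rewrite mul0r add0r mul1r.
  - rewrite mul0r add0r.
    exact: entryZ.
  - rewrite mul0r add0r.
    exact: entryZ.
exists c => //; split.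
- by move=> k v j v0; rewrite SE // pull_it_l mulr0 addr0 eqxx it_iu /= addr0.
- by move=> k v j v0; rewrite SE // pull_iu_l mulr0 addr0 eqxx iu_it /= add0r.
- move=> k v i j v0; rewrite !SE //; congr (_ * - _ + _ * _).
    by rewrite addrC [(i == iu) && _]andbC [(i == it) && _]andbC.
  by rewrite -[in LHS](cT k) -tr_pull mxE.
- by move=> k v i j v0; rewrite SE // pull_lshift !lshift_it !lshift_iu /=
    !mulr0n addr0 oppr0 mulr0 add0r.
Qed.

(** A directional derivative sees a function along one line only. This freezes the point of J while
    differentiating in t, whatever the regularity of the factor on J. *)
Lemma derive_eq_on_line (V W : normedModType R) (f g : V -> W) (x e : V) :
  (forall h : R, f (h *: e + x) = g (h *: e + x)) -> 'D_e f x = 'D_e g x.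
Proof.
move=> fg; have fgx : f x = g x by have := fg 0; rewrite scale0r add0r.
rewrite /derive fgx.
have -> // : (fun h : R => h^-1 *: ((f \o shift x) (h *: e) - g x)) =
             (fun h : R => h^-1 *: ((g \o shift x) (h *: e) - g x)).
by apply/funext => h /=; rewrite fg.
Qed.

(** Euler's relation for degree 2 - k in t. *)
Lemma derive_homogeneous k (f : 'rV[R]_5 -> R) (v : 'rV[R]_n6) : 0 < v 0 it1 ->
  partial it1 (fun w => w 0 it1 ^ (2 - k%:Z) * f (lsubmx w)) v =
  (2 - k%:R) / v 0 it1 * (v 0 it1 ^ (2 - k%:Z) * f (lsubmx v)).
Proof.
move=> v0; set e : 'rV[R]_n6 := delta_mx 0 it1.
have -> : partial it1 (fun w => w 0 it1 ^ (2 - k%:Z) * f (lsubmx w)) v =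
    partial it1 (fun w => w 0 it1 ^ (2 - k%:Z) * f (lsubmx v)) v.
  have lsubE (h : R) : lsubmx (h *: e + v) = lsubmx v.
    by apply/rowP => j; rewrite !mxE eq_lrshift andbF mulr0 add0r.
  by apply: derive_eq_on_line => h; rewrite lsubE.
have coordP := @has_partial_coord R n6 [set w | 0 < w 0 it1] it1 it1.
have eqd (h h1 h2 : 'rV[R]_n6 -> R) : has_partial [set w | 0 < w 0 it1] it1 h h1 ->
    (forall w : 'rV[R]_n6, w 0 it1 != 0 -> h1 w = h2 w) ->
    has_partial [set w | 0 < w 0 it1] it1 h h2.
  by move=> hh e12 w w0; have [? ->] := hh w w0; split=> //; rewrite e12 // gt_eqF.
(* The exponent is negative for k > 2, hence one induction for each sign. *)
have powP (a : int) : has_partial [set w : 'rV[R]_n6 | 0 < w 0 it1] it1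
    (fun w => w 0 it1 ^ a) (fun w => a%:~R / w 0 it1 * w 0 it1 ^ a).
  case: a => m.
    elim: m => [|m IH].
      apply: (eqd _ (fun=> 0)); first exact: has_partial_cst.
      by move=> w _; rewrite mul0r mul0r.
    apply: (eqd _ (fun w => (it1 == it1)%:R * w 0 it1 ^ m
                     + w 0 it1 * (m%:Z%:~R / w 0 it1 * w 0 it1 ^ m))).
      apply: (@eq_has_partial _ _ _ _ _ (fun w => w 0 it1 * w 0 it1 ^ m)) => // [w|].
        by rewrite exprSz.
      exact: has_partialM.
    move=> w w0; rewrite eqxx exprSz; move: (w 0 it1 ^ m) => y.
    by rewrite -!pmulrn -natr1; field.
  have NegzR (p : nat) : (Negz p)%:~R = - p.+1%:R :> R by rewrite NegzE mulrNz.
  have powN (x : R) p : x ^ Negz p = (x ^+ p.+1)^-1 by [].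
  elim: m => [|m IH].
    apply: (eqd _ (fun w => - (it1 == it1)%:R * (w 0 it1)^-1 ^+ 2)).
      apply: has_partial_inv coordP => w w0; by rewrite gt_eqF.
    by move=> w w0; rewrite eqxx mulr1n NegzR powN; field.
  apply: (eqd _ (fun w => - (it1 == it1)%:R * (w 0 it1)^-1 ^+ 2 * w 0 it1 ^ Negz m
                   + (w 0 it1)^-1 * ((Negz m)%:~R / w 0 it1 * w 0 it1 ^ Negz m))).
    apply: (@eq_has_partial _ _ _ _ _ (fun w => (w 0 it1)^-1 * w 0 it1 ^ Negz m)) => // [w|].
      by rewrite !powN -invfM -exprS.
    apply: has_partialM => //; apply: has_partial_inv coordP => w w0; by rewrite gt_eqF.
  move=> w w0; rewrite eqxx mulr1n !NegzR !powN [w 0 it1 ^+ m.+2]exprS invfM.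
  by move: (w 0 it1 ^+ m.+1)^-1 => y; rewrite -[m.+2%:R]natr1; field.
have [_ ->] := has_partialM (powP (2 - k%:Z)) (has_partial_cst it1 (f (lsubmx v))) v0.
by rewrite mulr0 addr0 intrB mulrA.
Qed.

End NormalForm.

(** * Inverse and Christoffel symbols in normal form *)

Lemma christoffel_formalE (R : realType)
    (g h : 'I_(5 + 1 + 1) -> 'I_(5 + 1 + 1) -> nat -> 'rV[R]_(5 + 1) -> R^o) k i j m v :
  christoffel (@formal_mul R) (@formal_partial R) g h k i j m v =
  2^-1 * \sum_l formal_mul (h k l) (formal_partial i (g j l)
    + formal_partial j (g i l) - formal_partial l (g i j)) m v.
Proof.
rewrite -[LHS]/(2^-1 * (\sum_l formal_mul (h k l) (formal_partial i (g j l)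
  + formal_partial j (g i l) - formal_partial l (g i j))) m v).
by rewrite sum_formalE.
Qed.

Lemma ricci_formalE (R : realType)
    (g h : 'I_(5 + 1 + 1) -> 'I_(5 + 1 + 1) -> nat -> 'rV[R]_(5 + 1) -> R^o) i j m v :
  let G := christoffel (@formal_mul R) (@formal_partial R) g h in
  ricci (@formal_mul R) (@formal_partial R) g h i j m v =
  \sum_k (formal_partial k (G k i j) m v - formal_partial j (G k i k) m v)
  + \sum_k \sum_l (formal_mul (G k k l) (G l i j) m v
                   - formal_mul (G k j l) (G l i k) m v).
Proof.
move=> G; rewrite -[LHS]/(
    (\sum_k (formal_partial k (G k i j) - formal_partial j (G k i k))) m v
  + (\sum_k \sum_l (formal_mul (G k k l) (G l i j) - formal_mul (G k j l) (G l i k))) m v).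
rewrite !sum_formalE; congr (_ + _).
by apply: eq_bigr => k _; rewrite sum_formalE.
Qed.

Section Inverse.
Variables (R : realType) (S H : formal_form R) (c : nat -> 'rV[R]_5 -> 'M[R]_5).
Local Notation n6 := (5 + 1)%N.
Local Notation n7 := (5 + 1 + 1)%N.
Local Notation sp a := (lshift 1 (lshift 1 a)).
Hypotheses (nf : normal_form S c) (SH : formal_inverse S H).

Local Notation g := (fun i j : 'I_n7 => (fun k w => S k w i j) : nat -> 'rV[R]_n6 -> R^o).
Local Notation h := (fun i j : 'I_n7 => (fun k w => H k w i j) : nat -> 'rV[R]_n6 -> R^o).
Local Notation G := (christoffel (@formal_mul R) (@formal_partial R) g h).

(** Row u of [S] is the constant -dt, so row u of the equation S H = 1 determines row t of [H] at
    every order. *)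
Lemma inverse_it k (v : 'rV[R]_n6) j : 0 < v 0 it1 ->
  H k v it j = (k == 0%N)%:R * - (j == iu)%:R.
Proof.
move=> v0; have := SH iu j k v0.
under eq_bigr => l _.
  rewrite (@formal_mul_const _ _ _ (- (l == it)%:R)); first over.
  by move=> m; rewrite (normal_iu nf).
rewrite (bigD1 it) // eqxx /= big1 ?addr0 => [|l /negPf ->]; last by rewrite oppr0 mul0r.
move=> /(congr1 -%R); rewrite mulN1r opprK => ->.
by rewrite mulrN -natrM mulnb (eq_sym j).
Qed.

Lemma inverse_iu k (v : 'rV[R]_n6) j : 0 < v 0 it1 ->
  H k v iu j = (k == 0%N)%:R * - (j == it)%:R.
Proof.
move=> v0; have := SH it j k v0.
under eq_bigr => l _.
  rewrite (@formal_mul_const _ _ _ (- (l == iu)%:R)); first over.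
  by move=> m; rewrite (normal_it nf).
rewrite (bigD1 iu) // eqxx /= big1 ?addr0 => [|l /negPf ->]; last by rewrite oppr0 mul0r.
move=> /(congr1 -%R); rewrite mulN1r opprK => ->.
by rewrite mulrN -natrM mulnb (eq_sym j).
Qed.

Lemma inverse0_mx (v : 'rV[R]_n6) : 0 < v 0 it1 -> S 0%N v *m H 0%N v = 1%:M.
Proof.
move=> v0; apply/matrixP => i j; rewrite !mxE; have := SH i j 0%N v0.
rewrite /= => <-; apply: eq_bigr => l _.
by rewrite /formal_mul big_ord1.
Qed.

Lemma inverse0_r (v : 'rV[R]_n6) i j : 0 < v 0 it1 ->
  \sum_l S 0%N v i l * H 0%N v l j = (i == j)%:R.
Proof. by move=> /inverse0_mx /matrixP/(_ i j); rewrite !mxE. Qed.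

Lemma inverse0_l (v : 'rV[R]_n6) i j : 0 < v 0 it1 ->
  \sum_l H 0%N v i l * S 0%N v l j = (i == j)%:R.
Proof. by move=> /inverse0_mx /mulmx1C /matrixP/(_ i j); rewrite !mxE. Qed.

(** [H] is given as a right inverse, without symmetry; its column u comes from the left inverse at
    order 0 and the symmetry of [S]. *)
Lemma inverse0_col_iu (v : 'rV[R]_n6) k : 0 < v 0 it1 ->
  H 0%N v k iu = - (k == it)%:R.
Proof.
move=> v0; have := inverse0_l k it v0.
rewrite (bigD1 iu) //= (normal_iu nf) // !eqxx big1 => [|l /negPf lu].
  by rewrite addr0 mul1r mulrN mulr1 => /(congr1 -%R); rewrite opprK.
by rewrite (normal_sym nf) // (normal_it nf) // lu oppr0 !mulr0.
Qed.

Lemma formal_partial_const (x : R) i (a : nat -> 'rV[R]_n6 -> R^o) k (v : 'rV[R]_n6) :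
  (forall m (w : 'rV[R]_n6), 0 < w 0 it1 -> a m w = (m == 0%N)%:R * x) ->
  0 < v 0 it1 -> formal_partial i a k v = 0.
Proof.
move=> ha v0; case: (ord_caseP i) => [[j ->]| ->].
  rewrite formal_partial_lshift.
  rewrite (partial_eq_on (@open_coord_gt0 R n6 it1) j (g := fun=> (k == 0%N)%:R * x) _ v0).
    exact: derive_cst.
  by move=> w w0; exact: ha.
by rewrite formal_partial_iu ha // mul0r mulr0.
Qed.

Lemma formal_partial_it i j k (v : 'rV[R]_n6) : 0 < v 0 it1 ->
  formal_partial i (g it j) k v = 0 /\ formal_partial i (g j it) k v = 0.
Proof.
move=> v0; split; apply: (@formal_partial_const (- (j == iu)%:R)) => // m w w0.
  by rewrite (normal_it nf).
by rewrite (normal_sym nf) // (normal_it nf).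
Qed.

Lemma formal_partial_giu i j k (v : 'rV[R]_n6) : 0 < v 0 it1 ->
  formal_partial i (g iu j) k v = 0 /\ formal_partial i (g j iu) k v = 0.
Proof.
move=> v0; split; apply: (@formal_partial_const (- (j == it)%:R)) => // m w w0.
  by rewrite (normal_iu nf).
by rewrite (normal_sym nf) // (normal_iu nf).
Qed.

(** An upper index t is minus a lower index u, and the components g_(iu) are constant, so of the
    three derivatives only that of g_(ij) in u survives. *)
Lemma christoffel_it i j k (v : 'rV[R]_n6) : 0 < v 0 it1 ->
  G it i j k v = 2^-1 * formal_partial iu (g i j) k v.
Proof.
move=> v0; rewrite christoffel_formalE; congr (_ * _).
under eq_bigr => l _.
  rewrite (@formal_mul_const _ _ _ (- (l == iu)%:R)); first over.
  by move=> m; rewrite inverse_it.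
rewrite (bigD1 iu) // eqxx /= big1 ?addr0 => [|l /negPf ->]; last by rewrite oppr0 mul0r.
have [_ e1] := formal_partial_giu i j k v0.
have [_ e2] := formal_partial_giu j i k v0.
rewrite -[X in _ * X]/(formal_partial i (g j iu) k v + formal_partial j (g i iu) k v
  - formal_partial iu (g i j) k v).
by rewrite e1 e2 addr0 add0r mulrNN mul1r.
Qed.

Lemma christoffel_iu i j k (v : 'rV[R]_n6) : 0 < v 0 it1 ->
  G iu i j k v = 2^-1 * formal_partial it (g i j) k v.
Proof.
move=> v0; rewrite christoffel_formalE; congr (_ * _).
under eq_bigr => l _.
  rewrite (@formal_mul_const _ _ _ (- (l == it)%:R)); first over.
  by move=> m; rewrite inverse_iu.
rewrite (bigD1 it) // eqxx /= big1 ?addr0 => [|l /negPf ->]; last by rewrite oppr0 mul0r.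
have [_ e1] := formal_partial_it i j k v0.
have [_ e2] := formal_partial_it j i k v0.
rewrite -[X in _ * X]/(formal_partial i (g j it) k v + formal_partial j (g i it) k v
  - formal_partial it (g i j) k v).
by rewrite e1 e2 addr0 add0r mulrNN mul1r.
Qed.

Lemma formal_partial_it_sp (i j : 'I_5) k (v : 'rV[R]_n6) : 0 < v 0 it1 ->
  formal_partial it (g (sp i) (sp j)) k v =
  (2 - k%:R) / v 0 it1 * S k v (sp i) (sp j).
Proof.
move=> v0; rewrite formal_partial_lshift (normal_sp nf) //.
rewrite -(derive_homogeneous k (fun y => c k y i j) v0).
apply: (partial_eq_on (@open_coord_gt0 R n6 it1)) => // w w0.
by rewrite (normal_sp nf).
Qed.

(** The t-derivative of Gamma^t_(ij) and the u-derivative of Gamma^u_(ij) are both half the mixed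
    derivative of g_(ij), whence the same value here and in the next lemma. *)
Lemma partial_it_christoffel_it (i j : 'I_5) k (v : 'rV[R]_n6) : 0 < v 0 it1 ->
  formal_partial it (G it (sp i) (sp j)) k v =
  2^-1 * k.+1%:R * ((2 - k.+1%:R) / v 0 it1 * S k.+1 v (sp i) (sp j)).
Proof.
move=> v0; rewrite formal_partial_lshift (normal_sp nf) //.
pose f (y : 'rV[R]_5) := 2^-1 * k.+1%:R * c k.+1 y i j.
transitivity (partial it1 (fun w => w 0 it1 ^ (2 - k.+1%:Z) * f (lsubmx w)) v).
  apply: (partial_eq_on (@open_coord_gt0 R n6 it1)) => // w w0.
  by rewrite christoffel_it // formal_partial_iu (normal_sp nf) // /f; ring.
by rewrite derive_homogeneous // /f; ring.
Qed.

Lemma partial_iu_christoffel_iu (i j : 'I_5) k (v : 'rV[R]_n6) : 0 < v 0 it1 ->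
  formal_partial iu (G iu (sp i) (sp j)) k v =
  2^-1 * k.+1%:R * ((2 - k.+1%:R) / v 0 it1 * S k.+1 v (sp i) (sp j)).
Proof.
move=> v0; rewrite formal_partial_iu christoffel_iu // formal_partial_it_sp //.
by rewrite mulrCA mulrA.
Qed.

End Inverse.

(** The system is triangular with the invertible block [A 0%N] on the diagonal. *)
Lemma convolution_eq0 (R : realType) (n p m : nat) (A : nat -> 'M[R]_n)
    (x : nat -> 'M[R]_(n, p)) : A 0%N \in unitmx ->
  (forall k, (k < m)%N -> \sum_(i < k.+1) A i *m x (k - i)%N = 0) ->
  forall k, (k < m)%N -> x k = 0.
Proof.
move=> A0 h; elim/ltn_ind => k IH km; have := h k km.
rewrite big_ord_recl subn0 big1 ?addr0 => [Ax|i _]; last first.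
  have ik : (k - bump 0 i < k)%N.
    by rewrite /bump leq0n add1n ltn_subrL /= (leq_ltn_trans _ (ltn_ord i)).
  by rewrite IH ?mulmx0 // (ltn_trans ik).
by rewrite -[x k](mulKmx A0) Ax mulmx0.
Qed.

Lemma formal_inverse_mx (R : realType) (S H : formal_form R) k (v : 'rV[R]_(5 + 1)) :
  formal_inverse S H -> 0 < v 0 it1 ->
  \sum_(i < k.+1) S i v *m H (k - i)%N v = (k == 0%N)%:R%:M.
Proof.
move=> SH v0; apply/matrixP => i j; rewrite mxE summxE.
transitivity (\sum_l \sum_(m < k.+1) S m v i l * H (k - m)%N v l j).
  by rewrite exchange_big; apply: eq_bigr => m _; rewrite mxE.
rewrite [LHS](SH i j k v v0); case: (k == 0%N) => /=; last by rewrite mul0rn.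
by rewrite mulrb.
Qed.

(** * The first order at which two Ricci flat series could differ *)

Section Uniqueness.
Variables (R : realType) (S S' H H' : formal_form R).
Variables (c c' : nat -> 'rV[R]_5 -> 'M[R]_5) (n : nat).
Local Notation n6 := (5 + 1)%N.
Local Notation n7 := (5 + 1 + 1)%N.
Local Notation sp a := (lshift 1 (lshift 1 a)).
Local Notation fn X := (fun i j : 'I_n7 => (fun k w => X k w i j) : nat -> 'rV[R]_n6 -> R^o).
Local Notation G := (christoffel (@formal_mul R) (@formal_partial R) (fn S) (fn H)).
Local Notation G' := (christoffel (@formal_mul R) (@formal_partial R) (fn S') (fn H')).
Local Notation ric := (ricci (@formal_mul R) (@formal_partial R) (fn S) (fn H)).
Local Notation ric' := (ricci (@formal_mul R) (@formal_partial R) (fn S') (fn H')).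

Hypotheses (nf : normal_form S c) (nf' : normal_form S' c').
Hypotheses (SH : formal_inverse S H) (SH' : formal_inverse S' H').
Hypothesis flat : forall i j k (v : 'rV[R]_n6), 0 < v 0 it1 -> ric i j k v = 0.
Hypothesis flat' : forall i j k (v : 'rV[R]_n6), 0 < v 0 it1 -> ric' i j k v = 0.
Hypothesis agree : forall k (v : 'rV[R]_n6), (k <= n)%N -> 0 < v 0 it1 -> S' k v = S k v.

Let gE i j : eq_upto n.+1 (fn S i j) (fn S' i j).
Proof. by move=> k v kn v0; rewrite agree. Qed.

(** Convolving [S] with H' - H gives 0 through order n, because both inverses solve the same
    equations there. *)
Let hE i j : eq_upto n.+1 (fn H i j) (fn H' i j).
Proof.
move=> k v kn v0; suff /subr0_eq -> : H' k v - H k v = 0 by [].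
have [S0 _] := mulmx1_unit (inverse0_mx SH v0).
apply: (@convolution_eq0 _ _ _ n.+1 (S^~ v) (fun k => H' k v - H k v)) kn => // m mn.
under eq_bigr do rewrite mulmxBr.
rewrite sumrB (formal_inverse_mx _ SH v0) -(formal_inverse_mx _ SH' v0).
apply/eqP; rewrite subr_eq0; apply/eqP; apply: eq_bigr => l _.
by rewrite agree // -ltnS (leq_trans (ltn_ord l)).
Qed.

Let d (v : 'rV[R]_n6) (i j : 'I_n7) : R := S' n.+1 v i j - S n.+1 v i j.
(** [d] with one index raised by the leading inverse; [tau] is its trace. The factor [K] joins the
    one half of the Christoffel symbols and the n + 1 from differentiating u^(n+1). *)
Let hd (v : 'rV[R]_n6) (k i : 'I_n7) : R := \sum_l H 0%N v k l * d v i l.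
Let tau (v : 'rV[R]_n6) : R := \sum_k hd v k k.
Let K : R := 2^-1 * n.+1%:R.

Let K_neq0 : K != 0.
Proof. by rewrite mulf_neq0 ?invr_eq0 ?pnatr_eq0. Qed.

Let dC (v : 'rV[R]_n6) i j : 0 < v 0 it1 -> d v i j = d v j i.
Proof. by move=> v0; rewrite /d (normal_sym nf) // (normal_sym nf'). Qed.

Let d_it (v : 'rV[R]_n6) j : 0 < v 0 it1 -> d v it j = 0.
Proof. by move=> v0; rewrite /d (normal_it nf) // (normal_it nf') // subrr. Qed.

Let d_iu (v : 'rV[R]_n6) j : 0 < v 0 it1 -> d v iu j = 0.
Proof. by move=> v0; rewrite /d (normal_iu nf) // (normal_iu nf') // subrr. Qed.

Let hd_it (v : 'rV[R]_n6) i : 0 < v 0 it1 -> hd v it i = 0.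
Proof.
move=> v0; rewrite /hd big1 // => l _; rewrite (inverse_it nf SH) // eqxx mul1r.
by case: eqP => [->|_]; rewrite ?oppr0 ?mul0r // dC // d_iu // mulr0.
Qed.

Let hd_iu (v : 'rV[R]_n6) i : 0 < v 0 it1 -> hd v iu i = 0.
Proof.
move=> v0; rewrite /hd big1 // => l _; rewrite (inverse_iu nf SH) // eqxx mul1r.
by case: eqP => [->|_]; rewrite ?oppr0 ?mul0r // dC // d_it // mulr0.
Qed.

Let hd_iu_r (v : 'rV[R]_n6) k : 0 < v 0 it1 -> hd v k iu = 0.
Proof. by move=> v0; rewrite /hd big1 // => l _; rewrite d_iu // mulr0. Qed.

Let lowerE i j l : eq_upto n
  (formal_partial i (fn S j l) + formal_partial j (fn S i l) - formal_partial l (fn S i j))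
  (formal_partial i (fn S' j l) + formal_partial j (fn S' i l) - formal_partial l (fn S' i j)).
Proof.
move=> k v kn v0.
rewrite -[LHS]/(formal_partial i (fn S' j l) k v + formal_partial j (fn S' i l) k v
  - formal_partial l (fn S' i j) k v).
by rewrite !(eq_upto_partial _ (gE _ _) kn v0).
Qed.

(** One order of agreement is lost to the derivative in u. *)
Let GE k i j : eq_upto n (G k i j) (G' k i j).
Proof.
move=> m v mn v0; rewrite !christoffel_formalE; congr (_ * _).
apply: eq_bigr => l _; apply: (eq_upto_mul _ _ mn v0); last exact: lowerE.
exact: eq_upto_leq (hE k l).
Qed.

(* The only first-order contributions of [d] to the Christoffel symbols come
   from derivatives with respect to u. *)
Let G_diff (v : 'rV[R]_n6) k i j : 0 < v 0 it1 ->
  G' k i j n v - G k i j n v =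
  K * ((i == iu)%:R * hd v k j + (j == iu)%:R * hd v k i + (k == it)%:R * d v i j).
Proof.
move=> v0; rewrite !christoffel_formalE -mulrBr -mulrA; congr (_ * _).
rewrite -sumrB.
transitivity (\sum_l H 0%N v k l * (n.+1%:R * ((i == iu)%:R * d v j l
    + (j == iu)%:R * d v i l - (l == iu)%:R * d v i j))).
  apply: eq_bigr => l _.
  rewrite (formal_mul_diff (eq_upto_leq (leqnSn n) (hE k l)) (lowerE i j l) v0).
  rewrite (hE k l (ltnSn n) v0) subrr !mul0r mulr0 !addr0; congr (_ * _).
  have e1 := formal_partial_diff i (gE j l) v0.
  have e2 := formal_partial_diff j (gE i l) v0.
  have e3 := formal_partial_diff l (gE i j) v0.
  have aux (x' x y' y z' z : R) : x' + y' - z' - (x + y - z) = (x' - x) + (y' - y) - (z' - z).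
    by ring.
  apply: etrans (aux _ _ _ _ _ _) _; rewrite e1 e2 e3 -/(d v j l) -/(d v i l) -/(d v i j).
  by ring.
under eq_bigr => l _.
  rewrite (_ : _ * _ = n.+1%:R * ((i == iu)%:R * (H 0%N v k l * d v j l)
    + (j == iu)%:R * (H 0%N v k l * d v i l)
    - (H 0%N v k l * (l == iu)%:R) * d v i j)); last by ring.
  over.
rewrite -mulr_sumr; congr (_ * _); rewrite sumrB big_split /= -!mulr_sumr -mulr_suml.
congr (_ + _); rewrite -mulNr; congr (_ * _).
rewrite (bigD1 iu) // eqxx /= mulr1 big1 ?addr0 => [|l /negPf ->]; last by rewrite mulr0.
by rewrite (inverse0_col_iu nf SH) // opprK.
Qed.

(** At order n - 1 the products of Christoffel symbols agree. In the (u, u) component [d] enters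
    only through the u-derivative of Gamma^k_(uk), since [d] and [hd] vanish along u. *)
Let trace_eq0 (v : 'rV[R]_n6) : (0 < n)%N -> 0 < v 0 it1 -> tau v = 0.
Proof.
move=> n_gt0 v0; have [p np] : exists p, n = p.+1 by exists n.-1; rewrite prednK.
have GEp k i j : eq_upto p.+1 (G k i j) (G' k i j) by rewrite -np; exact: GE.
have Gp k i j : G' k i j p v = G k i j p v by exact: (GEp k i j).
have dG k i j m : formal_partial m (G' k i j) p v - formal_partial m (G k i j) p v =
    (m == iu)%:R * (n%:R * (K * ((i == iu)%:R * hd v k j + (j == iu)%:R * hd v k i
       + (k == it)%:R * d v i j))).
  by rewrite (formal_partial_diff m (GEp k i j) v0) -np G_diff.
have prodE k l :
    formal_mul (G' k k l) (G' l iu iu) p v - formal_mul (G' k iu l) (G' l iu k) p v =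
    formal_mul (G k k l) (G l iu iu) p v - formal_mul (G k iu l) (G l iu k) p v.
  by rewrite !(eq_upto_mul (GEp _ _ _) (GEp _ _ _) (ltnSn p) v0).
have := etrans (flat' iu iu p v0) (esym (flat iu iu p v0)); rewrite !ricci_formalE.
under [X in _ + X = _]eq_bigr do under eq_bigr do rewrite prodE.
move/addIr => e.
have : \sum_k n%:R * (K * hd v k k) = 0.
  rewrite -[RHS](subrr (\sum_k (formal_partial k (G k iu iu) p v
    - formal_partial iu (G k iu k) p v))) -[X in _ = _ - X]e -sumrB.
  apply: eq_bigr => k _.
  have aux (x y x' y' : R) : x - y - (x' - y') = (y' - y) - (x' - x) by ring.
  apply: esym; apply: etrans (aux _ _ _ _) _.
  by rewrite !dG !eqxx hd_iu_r // d_iu // d_iu // !mulr0 !addr0 !mulr0 subr0 !mul1r.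
have n_neq0 : n%:R != 0 :> R by rewrite pnatr_eq0 -lt0n.
rewrite -mulr_sumr -mulr_sumr => nK.
by move/eqP: nK; rewrite mulf_eq0 (negPf n_neq0) mulf_eq0 (negPf K_neq0) !orFb => /eqP.
Qed.

Let d_t_0 (v : 'rV[R]_n6) (a : 'I_5) l : 0 < v 0 it1 ->
  formal_partial it (fn S (sp a) l) 0%N v = 2 / v 0 it1 * S 0%N v (sp a) l.
Proof.
move=> v0; case: (ord7P l) => [[b ->]| -> | ->].
- by rewrite (formal_partial_it_sp nf) // subr0.
- rewrite (formal_partial_it nf it (sp a) 0 v0).2 (normal_sym nf) // (normal_it nf) //.
  by rewrite lshift_iu oppr0 !mulr0.
- rewrite (formal_partial_giu nf it (sp a) 0 v0).2 (normal_sym nf) // (normal_iu nf) //.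
  by rewrite lshift_it oppr0 !mulr0.
Qed.

(** In the products, [d] is multiplied by Christoffel symbols of order 0. Those that occur are this
    family, [G0_t] and the trace 5 / t; all come from the leading term being homogeneous of degree 2
    in t. *)
Let G0_iu (v : 'rV[R]_n6) (a : 'I_5) l : 0 < v 0 it1 ->
  G iu (sp a) l 0%N v = S 0%N v (sp a) l / v 0 it1.
Proof.
by move=> v0; rewrite (christoffel_iu nf SH) // d_t_0 //; field; rewrite gt_eqF.
Qed.

Let G0_t (v : 'rV[R]_n6) (a : 'I_5) k : 0 < v 0 it1 ->
  G k (sp a) it 0%N v = (k == sp a)%:R / v 0 it1.
Proof.
move=> v0; rewrite christoffel_formalE.
transitivity (2^-1 * \sum_l (2 / v 0 it1) * (H 0%N v k l * S 0%N v l (sp a))).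
  congr (_ * _); apply: eq_bigr => l _; rewrite /formal_mul big_ord1 subn0.
  rewrite -[X in _ * X]/(formal_partial (sp a) (fn S it l) 0%N v
    + formal_partial it (fn S (sp a) l) 0%N v - formal_partial l (fn S (sp a) it) 0%N v).
  rewrite (formal_partial_it nf (sp a) l 0 v0).1 (formal_partial_it nf l (sp a) 0 v0).2.
  by rewrite d_t_0 // subr0 add0r (normal_sym nf _ l) //; ring.
by rewrite -mulr_sumr (inverse0_l SH) //; field; rewrite gt_eqF.
Qed.

Let S0_hd (v : 'rV[R]_n6) i j : 0 < v 0 it1 ->
  \sum_l S 0%N v j l * hd v l i = d v i j.
Proof.
move=> v0; rewrite /hd.
under eq_bigr do rewrite mulr_sumr.
rewrite exchange_big /=.
under eq_bigr => m _.
  under eq_bigr do rewrite mulrA.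
  rewrite -mulr_suml (inverse0_r SH) //; over.
rewrite (bigD1 j) // eqxx /= mul1r big1 ?addr0 // => m /negPf.
by rewrite eq_sym => ->; rewrite mul0r.
Qed.

Let sum_G0_t (v : 'rV[R]_n6) : 0 < v 0 it1 ->
  \sum_(k < n7) (G k k it 0%N v : R) = 5 / v 0 it1.
Proof.
move=> v0; rewrite sum_ord7 (christoffel_it nf SH) // (christoffel_iu nf SH) //.
rewrite (formal_partial_it nf iu it 0 v0).1 (formal_partial_giu nf it it 0 v0).1.
rewrite !mulr0 !addr0.
under eq_bigr => a _ do rewrite G0_t // eqxx mul1r.
by rewrite sumr_const card_ord mulr_natl.
Qed.

Let G_upto k i j :
  (forall w : 'rV[R]_n6, 0 < w 0 it1 -> G' k i j n w = G k i j n w) ->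
  eq_upto n.+1 (G k i j) (G' k i j).
Proof.
move=> h m w; rewrite ltnS leq_eqVlt => /orP[/eqP -> | mn] w0; first exact: h.
exact: GE.
Qed.

Let sum_delta (x : 'I_n7) (f : 'I_n7 -> R) : \sum_l (l == x)%:R * f l = f x.
Proof.
rewrite (bigD1 x) // eqxx /= mul1r big1 ?addr0 // => l /negPf ->.
by rewrite mul0r.
Qed.

(** Only k = t and k = u contribute, equally, each with the degree 2 - (n + 1) of coefficient n + 1
    in t. The terms differentiated along J agree, as their symbols agree through order n. *)
Let ricci_diff_derivatives (v : 'rV[R]_n6) (a b : 'I_5) : 0 < v 0 it1 ->
  \sum_k (formal_partial k (G' k (sp a) (sp b)) n v
          - formal_partial (sp b) (G' k (sp a) k) n v)
  - \sum_k (formal_partial k (G k (sp a) (sp b)) n v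
          - formal_partial (sp b) (G k (sp a) k) n v)
  = 2 * (K * ((1 - n%:R) / v 0 it1 * d v (sp a) (sp b))).
Proof.
move=> v0; rewrite -sumrB.
have trE k : formal_partial (sp b) (G' k (sp a) k) n v =
    formal_partial (sp b) (G k (sp a) k) n v.
  apply: (eq_upto_partial_lshift _ (G_upto _) (ltnSn n) v0) => w w0.
  apply: subr0_eq; rewrite G_diff // lshift_iu mul0r add0r.
  have -> : (k == iu)%:R * hd w k (sp a) = 0.
    by case: eqP => [->|_]; rewrite ?hd_iu // ?mulr0 // mul0r.
  have -> : (k == it)%:R * d w (sp a) k = 0.
    by case: eqP => [->|_]; rewrite ?mul0r // dC // d_it // mulr0.
  by rewrite addr0 mulr0.
under eq_bigr => k _.
  rewrite trE (_ : forall x y z : R, x - y - (z - y) = x - z); last by move=> *; ring.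
  over.
rewrite sum_ord7 big1 => [|k _]; last first.
  apply/eqP; rewrite subr_eq0; apply/eqP.
  apply: (eq_upto_partial_lshift _ (G_upto _) (ltnSn n) v0) => w w0.
  by apply: subr0_eq; rewrite G_diff // !lshift_iu lshift_it !mul0r !addr0 mulr0.
rewrite (partial_it_christoffel_it nf SH) // (partial_it_christoffel_it nf' SH') //.
rewrite (partial_iu_christoffel_iu nf SH) // (partial_iu_christoffel_iu nf' SH') //.
by rewrite add0r /d /K -natr1; ring.
Qed.

(** Up to the factor K / t, six terms are linear in [d]: Gamma^k_(kt) yields 5 d, the trace times
    Gamma^u_(ab) yields tau S, and the remaining four yield -d each. *)
Let ricci_diff_products (v : 'rV[R]_n6) (a b : 'I_5) : 0 < v 0 it1 ->
  \sum_k \sum_l (formal_mul (G' k k l) (G' l (sp a) (sp b)) n v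
               - formal_mul (G' k (sp b) l) (G' l (sp a) k) n v)
  - \sum_k \sum_l (formal_mul (G k k l) (G l (sp a) (sp b)) n v
               - formal_mul (G k (sp b) l) (G l (sp a) k) n v)
  = K / v 0 it1 * (d v (sp a) (sp b) + tau v * S 0%N v (sp a) (sp b)).
Proof.
move=> v0; rewrite -sumrB.
set i := sp a; set j := sp b.
have fmE := fun k l p q r s => formal_mul_diff (GE k l p) (GE q r s) v0.
transitivity (\sum_k \sum_l (
    (l == it)%:R * (K * d v i j * G k k l 0%N v)
  + (l == iu)%:R * (K * hd v k k * G l i j 0%N v)
  - (k == iu)%:R * (K * hd v l i * G k j l 0%N v)
  - (l == it)%:R * (K * d v i k * G k j l 0%N v)
  - (l == iu)%:R * (K * hd v k j * G l i k 0%N v)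
  - (k == it)%:R * (K * d v j l * G l i k 0%N v))).
  apply: eq_bigr => k _; rewrite -sumrB; apply: eq_bigr => l _.
  have aux (x y x' y' : R) : x - y - (x' - y') = (x - x') - (y - y') by ring.
  apply: (etrans (aux _ _ _ _)).
  rewrite !fmE !G_diff // !lshift_iu !mul0r !add0r.
  have e1 : (k == iu)%:R * hd v k l = 0.
    by case: eqP => [->|_]; rewrite ?hd_iu // ?mulr0 // mul0r.
  have e2 : (k == it)%:R * d v k l = 0.
    by case: eqP => [->|_]; rewrite ?mul0r // d_it // mulr0.
  have e3 : (l == iu)%:R * (l == it)%:R = 0 :> R.
    by case: (l =P iu) => [->|_]; rewrite ?mul0r ?mulr0.
  have e4 : (k == iu)%:R * (k == it)%:R = 0 :> R.
    by case: (k =P iu) => [->|_]; rewrite ?mul0r ?mulr0.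
  have e5 : (k == iu)%:R * hd v k j = 0.
    by case: eqP => [->|_]; rewrite ?hd_iu // ?mulr0 // mul0r.
  have e6 : (l == it)%:R * d v j l = 0.
    by case: eqP => [->|_]; rewrite ?mul0r // dC // d_it // mulr0.
  rewrite e1 e2 add0r addr0.
  (* For n = 0 products of two differences also appear. They vanish because an index is never both t
     and u and because [d] and [hd] vanish on the indices t and u concerned. *)
  have cross1 : K * ((l == iu)%:R * hd v k k) * (K * ((l == it)%:R * d v i j)) = 0.
    by rewrite (_ : _ * _ = K * K * hd v k k * d v i j * ((l == iu)%:R * (l == it)%:R));
      [rewrite e3 mulr0 | ring].
  have cross2 : K * ((l == iu)%:R * hd v k j + (k == it)%:R * d v j l) *
      (K * ((k == iu)%:R * hd v l i + (l == it)%:R * d v i k)) = 0.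
    rewrite (_ : _ * _ = K * K * ((l == iu)%:R * hd v l i * ((k == iu)%:R * hd v k j)
      + hd v k j * d v i k * ((l == iu)%:R * (l == it)%:R)
      + d v j l * hd v l i * ((k == iu)%:R * (k == it)%:R)
      + (k == it)%:R * d v i k * ((l == it)%:R * d v j l))); last by ring.
    by rewrite e3 e4 e5 e6 !mulr0 !addr0 mulr0.
  rewrite cross1 cross2 !mulr0 !addr0.
  move: (G k k l 0%N v) (G l i j 0%N v) (G k j l 0%N v) (G l i k 0%N v) => g1 g2 g3 g4.
  move: (hd v k k) (hd v l i) (hd v k j) (d v i j) (d v i k) (d v j l) => x1 x2 x3 y1 y2 y3.
  move: K (l == it)%:R (l == iu)%:R (k == iu)%:R (k == it)%:R => K0 n1 n2 n3 n4.
  by ring.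
transitivity (\sum_k (K * d v i j * G k k it 0%N v + K * hd v k k * G iu i j 0%N v
  - (k == iu)%:R * (\sum_l K * hd v l i * G k j l 0%N v)
  - K * d v i k * G k j it 0%N v - K * hd v k j * G iu i k 0%N v
  - (k == it)%:R * (\sum_l K * d v j l * G l i k 0%N v))).
  apply: eq_bigr => k _.
  by rewrite !sumrB big_split /= !sum_delta -!mulr_sumr.
rewrite !sumrB big_split /= !sum_delta -mulr_suml.
under [X in _ - X - _ - _ - _]eq_bigr => l _ do rewrite G0_iu //.
under [X in _ - X - _ - _]eq_bigr => l _ do rewrite G0_t //.
under [X in _ - X - _]eq_bigr => l _ do rewrite G0_iu //.
under [X in _ - X]eq_bigr => l _ do rewrite G0_t //.
have sum_hd x y : \sum_l K * hd v l x * (S 0%N v y l / v 0 it1) = K / v 0 it1 * d v x y.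
  rewrite -(S0_hd x y v0) mulr_sumr; apply: eq_bigr => l _.
  by move: (hd v l x) => z; ring.
have sum_d x y : \sum_(l < n7) K * d v x l * ((l == y)%:R / v 0 it1) = K / v 0 it1 * d v x y.
  rewrite -(sum_delta y (d v x)) mulr_sumr; apply: eq_bigr => l _.
  by move: (d v x l) => z; ring.
have sum_G : \sum_(k < n7) K * d v i j * G k k it 0%N v = K * d v i j * (5 / v 0 it1).
  by rewrite -(sum_G0_t v0) mulr_sumr.
rewrite sum_G -mulr_sumr G0_iu // -/(tau v) !sum_hd !sum_d -/i -/j (dC j i) //.
move: (d v i j) (tau v) K => x y k.
by field; rewrite gt_eqF.
Qed.

Let ricci_diff (v : 'rV[R]_n6) (a b : 'I_5) : 0 < v 0 it1 ->
  (3 - 2 * n%:R) * d v (sp a) (sp b) + tau v * S 0%N v (sp a) (sp b) = 0.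
Proof.
move=> v0; have t0 : v 0 it1 != 0 by rewrite gt_eqF.
have := etrans (flat' (sp a) (sp b) n v0) (esym (flat (sp a) (sp b) n v0)).
rewrite !ricci_formalE => /eqP; rewrite -subr_eq0 => /eqP.
have aux (x y x' y' : R) : x + y - (x' + y') = (x - x') + (y - y') by ring.
move=> e; have {}e := etrans (esym (aux _ _ _ _)) e.
rewrite ricci_diff_derivatives // ricci_diff_products // in e.
apply: (mulfI (mulf_neq0 K_neq0 (invr_neq0 t0))); rewrite mulr0 -[RHS]e.
by move: (d v (sp a) (sp b)) (tau v) K => x y k; field.
Qed.

(** Contracting [ricci_diff] gives (8 - 2 n) tau = 0, which is empty at n = 4. It therefore serves
    only for n = 0, where there is no order n - 1 to look at in the (u, u) component. *)
Let trace0 (v : 'rV[R]_n6) : 0 < v 0 it1 -> tau v = 0.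
Proof.
move=> v0; case: (posnP n) => [n0|]; last by move=> n0; exact: trace_eq0.
have tauE : tau v = \sum_(a < 5) \sum_(b < 5) H 0%N v (sp a) (sp b) * d v (sp a) (sp b).
  rewrite /tau sum_ord7 hd_it // hd_iu // !addr0; apply: eq_bigr => a _.
  rewrite /hd sum_ord7 (dC (sp a) it) // (dC (sp a) iu) // d_it // d_iu //.
  by rewrite !mulr0 !addr0.
have gE5 : \sum_(a < 5) \sum_(b < 5) H 0%N v (sp a) (sp b) * S 0%N v (sp a) (sp b) = 5 :> R.
  transitivity (\sum_(a < 5) (1 : R)); last by rewrite sumr_const card_ord.
  apply: eq_bigr => a _; have := inverse0_l SH (sp a) (sp a) v0.
  rewrite eqxx mulr1n sum_ord7 (normal_it nf) // (normal_iu nf) //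
    lshift_it lshift_iu oppr0 !mulr0 !addr0.
  by move=> <-; apply: eq_bigr => b _; rewrite (normal_sym nf).
have : \sum_(a < 5) \sum_(b < 5) H 0%N v (sp a) (sp b) *
    ((3 - 2 * n%:R) * d v (sp a) (sp b) + tau v * S 0%N v (sp a) (sp b)) = 0.
  by rewrite big1 // => a _; rewrite big1 // => b _; rewrite ricci_diff // mulr0.
under eq_bigr => a _.
  under eq_bigr do rewrite mulrDr [_ * (tau v * _)]mulrCA [_ * (_ * d v _ _)]mulrCA.
  rewrite big_split /= -!mulr_sumr; over.
rewrite big_split /= -!mulr_sumr gE5 -tauE n0.
move: (tau v) => x /eqP; rewrite (_ : _ + _ = 8 * x); last by ring.
by rewrite mulf_eq0 pnatr_eq0 => /eqP.
Qed.

Lemma ambient_series_step i j (v : 'rV[R]_n6) : 0 < v 0 it1 ->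
  S' n.+1 v i j = S n.+1 v i j.
Proof.
move=> v0; apply: subr0_eq; rewrite -/(d v i j).
case: (ord7P i) => [[a ->]| -> | ->]; [|exact: d_it|exact: d_iu].
case: (ord7P j) => [[b ->]| -> | ->]; [|by rewrite dC // d_it|by rewrite dC // d_iu].
have := ricci_diff a b v0; rewrite trace0 // mul0r addr0 => /eqP.
rewrite mulf_eq0 => /orP[|/eqP //].
rewrite subr_eq0 -natrM eqr_nat => /eqP /(congr1 odd).
by rewrite oddM.
Qed.

End Uniqueness.

Lemma ambient_series_unique (R : realType) (g : 'rV[R]_5 -> 'M[R]_5) (S S' : formal_form R) :
  (forall y, (g y)^T = g y) ->
  has_ambient_form g S -> formal_ricci_flat S ->
  has_ambient_form g S' -> formal_ricci_flat S' ->
  forall k (v : 'rV[R]_(5 + 1)), 0 < v 0 it1 -> S' k v = S k v.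
Proof.
move=> gT aS [H SH flat] aS' [H' SH' flat'].
have [c nf c0] := has_ambient_form_normal gT aS.
have [c' nf' c0'] := has_ambient_form_normal gT aS'.
(* Order 0 is prescribed by g; each later order follows from all the earlier ones. *)
elim/ltn_ind => -[|n] IH v v0.
  apply/matrixP => i j.
  case: (ord7P i) => [[a ->]| -> | ->].
  - case: (ord7P j) => [[b ->]| -> | ->].
    + by rewrite (normal_sp nf) // (normal_sp nf') // c0 c0'.
    + by rewrite (normal_sym nf) // (normal_sym nf') // (normal_it nf) // (normal_it nf').
    + by rewrite (normal_sym nf) // (normal_sym nf') // (normal_iu nf) // (normal_iu nf').
  - by rewrite (normal_it nf) // (normal_it nf').
  - by rewrite (normal_iu nf) // (normal_iu nf').
apply/matrixP => i j.
apply: (@ambient_series_step R S S' H H' c c' n) => // k w kn w0.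
exact: IH.
Qed.

Theorem mainTheorem2 (R : realType) (a0 a1 a2 a3 a4 a5 a6 b : R) :
  [/\ metric_on [set: 'rV[R]_5] (gF a0 a1 a2 a3 a4 a5 a6 b) 3 2,
      exists U : set 'rV[R]_(5 + 1 + 1),
        [/\ open U,
            [set w : 'rV[R]_(5 + 1 + 1) | 0 < w 0 it /\ w 0 iu = 0] `<=` U,
            U `<=` [set w : 'rV[R]_(5 + 1 + 1) | 0 < w 0 it] &
            metric_on U (tgF a0 a1 a2 a3 a4 a5 a6 b) 4 3],
      forall w : 'rV[R]_(5 + 1 + 1), 0 < w 0 it ->
        ricci_tensor (tgF a0 a1 a2 a3 a4 a5 a6 b) w = 0 &
      is_ambient_metric (gF a0 a1 a2 a3 a4 a5 a6 b)
        (tgF a0 a1 a2 a3 a4 a5 a6 b)].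
Proof.
split.
- by split=> [i j|v _]; [exact: gF_smooth | exact: gF_signature].
(* The frame exists for every value of u, so the whole half space serves as neighbourhood. *)
- exists [set w : 'rV[R]_(5 + 1 + 1) | 0 < w 0 it]; split=> //.
  + exact: open_coord_gt0.
  + by move=> w [].
  + by split=> [i j|w w0]; [exact: tgF_smooth | exact: tgF_signature].
- exact: ricci_tgF.
- exists (tgF_series a0 a1 a2 a3 a4 a5 a6 b); last by move=> *; exact: tgF_series_cvg.
  have gT := gF_tr a0 a1 a2 a3 a4 a5 a6 b.
  split; [exact: tgF_series_has_ambient_form | exact: tgF_series_ricci_flat |].
  move=> S' aS' flat'; apply: ambient_series_unique gT _ _ aS' flat'.
    exact: tgF_series_has_ambient_form.
  exact: tgF_series_ricci_flat.
Qed.
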